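(* Let $\mathcal V$ be a complex vector space, $\Omega\subset\mathcal V_{\rm nc}$ a finitely open nc set, $\mathcal A$ a unital $C^*$-algebra, $\mathcal Y$ a Hilbert space. (1) Let $K$ be a cp nc kernel on $\Omega$ with values in $\mathcal L(\mathcal A,\mathcal L(\mathcal Y))_{\rm nc}$ that is $I$-locally bounded on slices. Let $(\mathcal H(K),\sigma)$ be the corresponding nc reproducing kernel Hilbert space and let $H$ be the factor in the corresponding minimal Kolmogorov decomposition. Then each $f\in\mathcal H(K)$ as well as $H$ are locally bounded on slices, even when the completely bounded norm is used in the target domain. More precisely, let $n\in\mathbb N$, $Z\in\Omega_n$, $D_Z\in\mathcal V^{n\times n}$ and assume that $K(Z+tD_Z,Z+tD_Z)(1_{\mathcal A^{n\times n}})$ is (defined and) bounded for $|t|<\epsilon$; then for each $f\in\mathcal H(K)$, $\|f(Z+tD_Z)\|$ and $\|f(Z+tD_Z)\|_{\rm cb}$ as well as $\|H(Z+tD_Z)\|$ and $\|H(Z+tD_Z)\|_{\rm cb}$ are bounded for $|t|<\epsilon$. (2) Conversely, let $\mathcal H$ be a nc functional Hilbert space on $\Omega$ with values in $\mathcal L(\mathcal A,\mathcal Y)_{\rm nc}$ with an $\mathcal A$-action. Assume that for all $n\in\mathbb N$, $Z\in\Omega_n$, $D_Z\in\mathcal V^{n\times n}$ there exists $\epsilon>0$ (independent of $f$) such that, for every $f\in\mathcal H$, $\|f(Z+tD_Z)\|$ is (defined and) bounded for $|t|<\epsilon$. Then the corresponding cp nc kernel $K$ (the one with $\mathcal H=\mathcal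 H(K)$ isometrically) is $P$-locally bounded on slices, even when the completely bounded norm is used in the target domain; more precisely, in the notation of the previous sentence, $\|K(Z+tD_Z,Z+tD_Z)(1_{\mathcal A^{n\times n}})\|=\|K(Z+tD_Z,Z+tD_Z)\|_{\rm cb}$ is bounded for $|t|<\epsilon$.
   Context: $\mathcal V_{\rm nc}=\coprod_{n\ge1}\mathcal V^{n\times n}$; $\Omega\subset\mathcal V_{\rm nc}$ is a nc set if closed under direct sums; $\Omega_n=\Omega\cap\mathcal V^{n\times n}$. $\Omega$ is finitely open if for each $W\in\Omega_m$ and $D\in\mathcal V^{m\times m}$ there is $\epsilon>0$ with $W+tD\in\Omega_m$ for all $t\in\mathbb C$, $|t|<\epsilon$. $\mathcal L(\mathcal X,\mathcal Y)^{n\times n}\cong\mathcal L(\mathcal X^n,\mathcal Y^n)$ (bounded operators). A nc function $f\colon\Omega\to\mathcal L(\mathcal X,\mathcal Y)_{\rm nc}$ satisfies $f(Z)\in\mathcal L(\mathcal X,\mathcal Y)^{n\times n}$ for $Z\in\Omega_n$, and $\alpha f(Z)=f(\widetilde Z)\alpha$ whenever $Z\in\Omega_n$, $\widetilde Z\in\Omega_m$, $\alpha\in\mathbb C^{m\times n}$, $\alpha Z=\widetilde Z\alpha$. A nc kernel $K\colon\Omega\times\Omega\to\mathcal L(\mathcal A,\mathcal L(\mathcal Y))_{\rm nc}$ assigns to $Z\in\Omega_n$, $W\in\Omega_m$ a linear map $K(Z,W)\colon\mathcal A^{n\times m}\to\mathcal L(\mathcal Y)^{n\times m}$ such that $\alpha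 K(Z,W)(P)\beta^*=K(\widetilde Z,\widetilde W)(\alpha P\beta^* )$ whenever $\alpha Z=\widetilde Z\alpha$, $\beta W=\widetilde W\beta$ for $\alpha\in\mathbb C^{\tilde n\times n}$, $\beta\in\mathbb C^{\tilde m\times m}$, $\widetilde Z\in\Omega_{\tilde n}$, $\widetilde W\in\Omega_{\tilde m}$, $P\in\mathcal A^{n\times m}$. It is cp if $K(Z,Z)(P)\succeq0$ whenever $Z\in\Omega_n$, $P\succeq0$ in $\mathcal A^{n\times n}$. $\mathcal A^n$ denotes columns, $\mathcal A^{1\times m}$ rows; $v^*$ is conjugate transpose. For a cp nc kernel $K$, $\mathcal H(K)$ is the unique Hilbert space of nc functions $f\colon\Omega\to\mathcal L(\mathcal A,\mathcal Y)_{\rm nc}$ such that: (a) for $W\in\Omega_m$, $v\in\mathcal A^{1\times m}$, $y\in\mathcal Y^m$ the function $K_{W,v,y}(Z)u=K(Z,W)(uv)y$ ($Z\in\Omega_n$, $u\in\mathcal A^n$) belongs to $\mathcal H(K)$; (b) $\langle f(W)(v^* ),y\rangle_{\mathcal Y^m}=\langle f,K_{W,v,y}\rangle_{\mathcal H(K)}$; (c) $(\sigma(a)f)(W)(v^* )=f(W)(v^*a)$ defines a unital $*$-representation $\sigma$ of $\mathcal A$ on $\mathcal H(K)$. A Kolmogorov decomposition of $K$ consists of a Hilbert space $\mathcal X$, a unital $*$-representation $\sigma_{\mathcal X}\colon\mathcal A\to\mathcal L(\mathcal X)$ and a nc function $H\colon\Omega\to\mathcal L(\mathcal X,\mathcal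 Y)_{\rm nc}$ with $K(Z,W)(P)=H(Z)(\mathrm{id}_{\mathbb C^{n\times m}}\otimes\sigma_{\mathcal X})(P)H(W)^*$; it is minimal if $\{(\mathrm{id}_{\mathbb C^{1\times m}}\otimes\sigma_{\mathcal X})(v)H(W)^*y\colon W\in\Omega_m,v\in\mathcal A^{1\times m},y\in\mathcal Y^m,m\in\mathbb N\}$ has dense span in $\mathcal X$. A nc functional Hilbert space on $\Omega$ with values in $\mathcal L(\mathcal A,\mathcal Y)_{\rm nc}$ with an $\mathcal A$-action is a Hilbert space $\mathcal H$ of nc functions $f\colon\Omega\to\mathcal L(\mathcal A,\mathcal Y)_{\rm nc}$ such that each evaluation $f\mapsto f(W)\in\mathcal L(\mathcal A^m,\mathcal Y^m)$ ($W\in\Omega_m$) is bounded and $(\sigma(a)f)(W)(u)=f(W)(ua)$ ($u\in\mathcal A^m$) defines a unital $*$-representation of $\mathcal A$ on $\mathcal H$. Any such $\mathcal H$ is isometrically equal to $\mathcal H(K)$ for a unique cp nc kernel $K$. $K$ is $P$-locally bounded on slices if for all $Z\in\Omega_n$, $W\in\Omega_m$, $P\in\mathcal A^{n\times m}$, $D_Z\in\mathcal V^{n\times n}$, $D_W\in\mathcal V^{m\times m}$ there is $\epsilon>0$ such that for $|t|<\epsilon$ one has $Z+tD_Z\in\Omega_n$, $W+tD_W\in\Omega_m$ and $\|K(Z+tD_Z,W+tD_W)(P)\|$ is bounded. $I$-locally bounded on slices is the same condition only for $Z=W$, $D_Z=D_W$, $P=1_{\mathcal A^{n\times n}}$. A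 nc function $f$ is locally bounded on slices if for all $Z\in\Omega_n$, $D_Z\in\mathcal V^{n\times n}$ there is $\epsilon>0$ such that $Z+tD_Z\in\Omega_n$ and $\|f(Z+tD_Z)\|$ is bounded for $|t|<\epsilon$. The cb-norm of a linear map $\varphi$ between operator spaces is $\sup_N\|\mathrm{id}_{\mathbb C^{N\times N}}\otimes\varphi\|$; matrices over $\mathcal A$ carry their $C^*$-norms (for $\mathcal A\subset\mathcal L(\mathcal E)$, $\mathcal A^{p\times q}\subset\mathcal L(\mathcal E^q,\mathcal E^p)$, with $\mathcal A^m=\mathcal A^{m\times1}$), and Hilbert spaces carry the column operator space structure $\mathcal Y\cong\mathcal L(\mathbb C,\mathcal Y)$. *)

(* Defs.v *)
From HB Require Import structures.
From mathcomp Require Import all_boot all_order all_algebra.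
From mathcomp Require Import complex.
From mathcomp Require Import all_classical all_reals all_analysis.

Set Implicit Arguments.
Unset Strict Implicit.
Unset Printing Implicit Defensive.

Import Order.TTheory GRing.Theory Num.Theory.
Import numFieldNormedType.Exports.

Local Open Scope classical_set_scope.
Local Open Scope ring_scope.

(* Inner products are linear in the first variable. *)
HB.mixin Record hasInner (R : realType) X of GRing.Lmodule R[i] X := {
  inner : {dot X for (@Num.conj R[i])}
}.

#[short(type="preHilbertType")]
HB.structure Definition PreHilbert (R : realType) :=
  { X of GRing.Lmodule R[i] X & hasInner R X }.

HB.mixin Record PreHilbert_isHilbert (R : realType) X
    of PreHilbert R X & CompleteNormedModule R[i] X := {
  inner_norm : forall x : X, inner x x = `|x| ^+ 2
}.

#[short(type="hilbertType")]
HB.structure Definition Hilbert (R : realType) :=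
  { X of PreHilbert R X & CompleteNormedModule R[i] X
       & PreHilbert_isHilbert R X }.

(* The norm is a field of its own rather than a normedModType structure, which
   Hierarchy Builder cannot join with a ring structure: the two already meet in
   numDomainType. *)
HB.mixin Record isCStarAlgebra (R : realType) A of GRing.Algebra R[i] A := {
  star : A -> A;
  starK : involutive star;
  starD : {morph star : a b / a + b};
  starZ : forall (c : R[i]) (a : A), star (c *: a) = c^* *: star a;
  starM : forall a b : A, star (a * b) = star b * star a;
  cnorm : A -> R;
  cnorm_eq0 : forall a : A, cnorm a = 0 -> a = 0;
  cnormD : forall a b : A, cnorm (a + b) <= cnorm a + cnorm b;
  cnormZ : forall (c : R[i]) (a : A), cnorm (c *: a) = complex.Re `|c| * cnorm a;
  cnormM : forall a b : A, cnorm (a * b) <= cnorm a * cnorm b;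
  cnorm_star : forall a : A, cnorm (star a * a) = cnorm a ^+ 2;
  cnorm_complete : forall u : nat -> A,
    (forall e : R, 0 < e -> exists N, forall m n,
       (N <= m)%N -> (N <= n)%N -> cnorm (u m - u n) < e) ->
    exists l : A, (fun n => cnorm (u n - l)) @ \oo --> (0 : R)
}.

#[short(type="cstarAlgType")]
HB.structure Definition CStarAlgebra (R : realType) :=
  { A of GRing.Algebra R[i] A & isCStarAlgebra R A }.

Section scalar_line.
Context (R : realType).
Local Notation C := R[i].

Definition line_inner (x y : C^o) : C := x * y^*.

Let line_inner_bilinear : bilinear_for
  ( *%R : GRing.Scale.law C C) (Num.conj \; *%R : GRing.Scale.law C C)
  line_inner.
Proof.
split=> [y a x x' | x a y y']; rewrite /line_inner /=.
  by rewrite mulrDl mulrA.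
by rewrite rmorphD rmorphM /= mulrDr mulrCA.
Qed.

HB.instance Definition _ :=
  bilinear_isBilinear.Build C C^o C^o C *%R (Num.conj \; *%R) line_inner
    line_inner_bilinear.

Let line_inner_herm (x y : C^o) :
  line_inner x y = (-1) ^+ false * Num.conj (line_inner y x).
Proof. by rewrite expr0 mul1r /line_inner rmorphM /= conjCK mulrC. Qed.

HB.instance Definition _ :=
  isHermitianSesquilinear.Build C C^o false Num.conj line_inner line_inner_herm.

Let line_inner_pos (x : C^o) : x != 0 -> 0 < line_inner x x.
Proof. by move=> x0; rewrite /line_inner -normCK exprn_gt0// normr_gt0. Qed.

HB.instance Definition _ :=
  isDotProduct.Build C C^o line_inner line_inner_pos.

HB.instance Definition _ := hasInner.Build R C^o (line_inner : {dot _ for _}).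

End scalar_line.

(* X ^ n is MathComp's {ffun 'I_n -> X}: the space X^n of columns. *)
Section columns.
Context (R : realType) (X : preHilbertType R) (n : nat).
Local Notation C := R[i].

Definition col_inner (x y : X ^ n) : C := \sum_i inner (x i) (y i).

Let col_inner_bilinear : bilinear_for
  ( *%R : GRing.Scale.law C C) (Num.conj \; *%R : GRing.Scale.law C C)
  col_inner.
Proof.
split=> [y a x x' | x a y y']; rewrite /col_inner /= mulr_sumr -big_split /=;
  apply: eq_bigr => i _; rewrite !ffunE.
  by rewrite linearDl linearZl_LR.
by rewrite linearDr linearZr.
Qed.

HB.instance Definition _ :=
  bilinear_isBilinear.Build C (X ^ n)%type (X ^ n)%type C
    *%R (Num.conj \; *%R) col_inner col_inner_bilinear.

Let col_inner_herm (x y : X ^ n) :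
  col_inner x y = (-1) ^+ false * Num.conj (col_inner y x).
Proof.
rewrite expr0 mul1r rmorph_sum /=; apply: eq_bigr => i _.
by rewrite (hermC inner) expr0 mul1r.
Qed.

HB.instance Definition _ :=
  isHermitianSesquilinear.Build C (X ^ n)%type false Num.conj col_inner
    col_inner_herm.

Let col_inner_pos (x : X ^ n) : x != 0 -> 0 < col_inner x x.
Proof.
move=> x0; rewrite lt_def sumr_ge0 ?andbT => [|i _]; last exact: dnorm_ge0.
apply: contra x0; rewrite psumr_eq0 => [/allP xi0|i _]; last exact: dnorm_ge0.
apply/eqP/ffunP => i; apply/eqP; rewrite ffunE -(dnorm_eq0 inner).
exact: xi0 (mem_index_enum i).
Qed.

HB.instance Definition _ :=
  isDotProduct.Build C (X ^ n)%type col_inner col_inner_pos.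

HB.instance Definition _ :=
  hasInner.Build R (X ^ n)%type (col_inner : {dot _ for _}).

End columns.

Section operators.
Context (R : realType).

Definition hnorm (X : preHilbertType R) (x : X) : R :=
  Num.sqrt (complex.Re (inner x x)).

Definition ehnorm (X : preHilbertType R) (x : X) : \bar R := (hnorm x)%:E.

(* The norm of a map between two spaces with given (extended) norms; it is +oo
   for an unbounded linear map. *)
Definition map_norm (S T : Type) (nS : S -> \bar R) (nT : T -> \bar R)
    (phi : S -> T) : \bar R :=
  ereal_sup [set nT (phi s) | s in [set s | (nS s <= 1)%E]].

Definition opnorm (X Y : preHilbertType R) (T : X -> Y) : \bar R :=
  map_norm (@ehnorm X) (@ehnorm Y) T.

Definition bounded_op (X Y : preHilbertType R) (T : X -> Y) : Prop :=
  linear T /\ (opnorm T < +oo)%E.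

Definition adjoint (X Y : preHilbertType R) (T : X -> Y) (y : Y) : X :=
  xget 0 [set z | forall x, inner (T x) y = inner x z].

Definition op_pos (X : preHilbertType R) (T : X -> X) : Prop :=
  forall x, 0 <= inner (T x) x.

(* A p x q matrix of operators X -> Y as an operator X^q -> Y^p. *)
Definition op_of_mx (X Y : preHilbertType R) p q (T : 'M[X -> Y]_(p, q))
    (x : X ^ q) : Y ^ p :=
  [ffun i => \sum_j T i j (x j)].

(* A concrete operator space: S realized as operators dom -> cod. *)
Record opspace (S : Type) := OpSpace {
  os_dom : preHilbertType R;
  os_cod : preHilbertType R;
  os_emb : S -> os_dom -> os_cod
}.
Arguments os_emb {S} o.

Definition os_norm S (o : opspace S) (s : S) : \bar R := opnorm (os_emb o s).

Definition os_mx S (o : opspace S) N : opspace 'M[S]_N :=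
  @OpSpace 'M[S]_N (os_dom o ^ N)%type (os_cod o ^ N)%type
    (fun s => op_of_mx (map_mx (os_emb o) s)).

Definition cbnorm S T (oS : opspace S) (oT : opspace T) (phi : S -> T) : \bar R :=
  ereal_sup (range (fun N : nat =>
    map_norm (os_norm (os_mx oS N)) (os_norm (os_mx oT N))
      (fun s : 'M[S]_N => map_mx phi s))).

Definition os_op (X Y : preHilbertType R) : opspace (X -> Y) :=
  @OpSpace (X -> Y) X Y id.

(* The column structure: Y = L(C, Y). *)
Definition os_column (Y : preHilbertType R) : opspace Y :=
  @OpSpace Y R[i]^o Y (fun y (c : R[i]^o) => c *: y).

Definition hcbnorm (X Y : preHilbertType R) (T : X -> Y) : \bar R :=
  cbnorm (os_column X) (os_column Y) T.

Definition lin_span (X : lmodType R[i]) (S : set X) : set X :=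
  [set x | exists k (c : 'I_k -> R[i]) (s : 'I_k -> X),
    (forall i, S (s i)) /\ x = \sum_i c i *: s i].

End operators.

Arguments os_emb {R S} o.

Section cstar_algebras.
Context (R : realType) (A : cstarAlgType R).

Definition star_mx p q (P : 'M[A]_(p, q)) : 'M[A]_(q, p) := (map_mx star P)^T.

Definition cstar_pos n (P : 'M[A]_n) : Prop :=
  exists Q : 'M[A]_n, P = star_mx Q *m Q.

Definition star_rep (X : hilbertType R) (sigma : A -> X -> X) : Prop :=
  [/\ forall a, bounded_op (sigma a),
      forall x, linear (sigma ^~ x),
      forall x, sigma 1 x = x,
      forall a b x, sigma (a * b) x = sigma a (sigma b x) &
      forall a x y, inner (sigma a x) y = inner x (sigma (star a) y)].

Definition isometric_rep (E : hilbertType R) (pi : A -> E -> E) : Prop :=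
  star_rep pi /\ forall a, opnorm (pi a) = (cnorm a)%:E.

(* Matrices over A as operators E^q -> E^p, for A in L(E) via pi. *)
Definition os_alg_mx (E : hilbertType R) (pi : A -> E -> E) p q :
    opspace R 'M[A]_(p, q) :=
  @OpSpace R 'M[A]_(p, q) (E ^ q)%type (E ^ p)%type
    (fun P => op_of_mx (map_mx pi P)).

Definition mx_of_col m (u : A ^ m) : 'cV[A]_m := \col_i u i.

Definition col_star m (v : 'rV[A]_m) : A ^ m := [ffun i => star (v 0 i)].

Definition col_mulr m (u : A ^ m) (a : A) : A ^ m := [ffun i => u i * a].

(* A^m = A^(m x 1) *)
Definition os_alg_col (E : hilbertType R) (pi : A -> E -> E) m :
    opspace R (A ^ m)%type :=
  @OpSpace R (A ^ m)%type (E ^ 1)%type (E ^ m)%type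
    (fun u => os_emb (os_alg_mx pi m 1) (mx_of_col u)).

End cstar_algebras.

Section nc.
Context (R : realType).
Local Notation C := R[i].

Definition lact (V : lmodType C) p q r (alpha : 'M[C]_(p, q))
    (Z : 'M[V]_(q, r)) : 'M[V]_(p, r) :=
  \matrix_(i, j) \sum_k alpha i k *: Z k j.

Definition ract (V : lmodType C) p q r (Z : 'M[V]_(p, q))
    (alpha : 'M[C]_(q, r)) : 'M[V]_(p, r) :=
  \matrix_(i, j) \sum_k alpha k j *: Z i k.

Definition cact (V : lmodType C) p q (alpha : 'M[C]_(p, q))
    (x : V ^ q) : V ^ p :=
  [ffun i => \sum_k alpha i k *: x k].

Definition mx_scale (V : lmodType C) p q (c : C) (Z : 'M[V]_(p, q)) :
    'M[V]_(p, q) :=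
  map_mx ( *:%R c) Z.

Definition adjmx p q (beta : 'M[C]_(p, q)) : 'M[C]_(q, p) :=
  (map_mx Num.conj beta)^T.

Context (V : lmodType C).

Definition ncset := forall n, set 'M[V]_n.

(* The first clause discards the size 0: V_nc starts at n = 1. *)
Definition is_ncset (Omega : ncset) : Prop :=
  (forall Z, ~ Omega 0%N Z) /\
  (forall n m (Z : 'M[V]_n) (W : 'M[V]_m), Omega n Z -> Omega m W ->
     Omega (n + m)%N (block_mx Z 0 0 W)).

Definition slice n (Z D : 'M[V]_n) (t : C) : 'M[V]_n := Z + mx_scale t D.

Definition slice_in (Omega : ncset) n (Z D : 'M[V]_n) (e : R) : Prop :=
  forall t : C, `|t| < e%:C%C -> Omega n (slice Z D t).

Definition bounded_disc (e : R) (g : C -> \bar R) : Prop :=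
  exists M : R, forall t : C, `|t| < e%:C%C -> (g t <= M%:E)%E.

Definition finitely_open (Omega : ncset) : Prop :=
  forall m (W D : 'M[V]_m), Omega m W ->
    exists2 e : R, 0 < e & slice_in Omega W D e.

Definition ncmap (S T : Type) := forall n, 'M[V]_n -> S ^ n -> T ^ n.

Definition nc_function (S T : lmodType C)
    (nS : forall n, S ^ n -> \bar R) (nT : forall n, T ^ n -> \bar R)
    (Omega : ncset) (f : ncmap S T) : Prop :=
  (forall n (Z : 'M[V]_n), Omega n Z ->
     linear (f n Z) /\ (map_norm (@nS n) (@nT n) (f n Z) < +oo)%E) /\
  (forall n m (Z : 'M[V]_n) (Z' : 'M[V]_m) (alpha : 'M[C]_(m, n)),
     Omega n Z -> Omega m Z' -> lact alpha Z = ract Z' alpha ->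
     forall x, cact alpha (f n Z x) = f m Z' (cact alpha x)).

Definition locally_bounded_on_slices (S T : Type)
    (norm : forall n, (S ^ n -> T ^ n) -> \bar R)
    (Omega : ncset) (f : ncmap S T) : Prop :=
  forall n (Z D : 'M[V]_n), Omega n Z ->
    exists e : R, [/\ 0 < e, slice_in Omega Z D e &
      bounded_disc e (fun t => norm n (f n (slice Z D t)))].

Context (A : cstarAlgType R) (Y : hilbertType R).

Definition nckernel := forall n m, 'M[V]_n -> 'M[V]_m ->
  'M[A]_(n, m) -> Y ^ m -> Y ^ n.

Definition is_nckernel (Omega : ncset) (K : nckernel) : Prop :=
  [/\ forall n m (Z : 'M[V]_n) (W : 'M[V]_m) P, Omega n Z -> Omega m W ->
        bounded_op (K n m Z W P),
      forall n m (Z : 'M[V]_n) (W : 'M[V]_m) c P Q y, Omega n Z -> Omega m W ->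
        K n m Z W (mx_scale c P + Q) y = c *: K n m Z W P y + K n m Z W Q y &
      forall n m n' m' (Z : 'M[V]_n) (W : 'M[V]_m) (Z' : 'M[V]_n')
          (W' : 'M[V]_m') (alpha : 'M[C]_(n', n)) (beta : 'M[C]_(m', m)) P y,
        Omega n Z -> Omega m W -> Omega n' Z' -> Omega m' W' ->
        lact alpha Z = ract Z' alpha -> lact beta W = ract W' beta ->
        cact alpha (K n m Z W P (cact (adjmx beta) y)) =
        K n' m' Z' W' (ract (lact alpha P) (adjmx beta)) y].

Definition cp_nckernel (Omega : ncset) (K : nckernel) : Prop :=
  is_nckernel Omega K /\
  forall n (Z : 'M[V]_n) P, Omega n Z -> cstar_pos P -> op_pos (K n n Z Z P).

Definition I_locally_bounded_on_slices (Omega : ncset) (K : nckernel) : Prop :=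
  forall n (Z D : 'M[V]_n), Omega n Z ->
    exists e : R, [/\ 0 < e, slice_in Omega Z D e &
      bounded_disc e (fun t => opnorm (K n n (slice Z D t) (slice Z D t) 1%:M))].

Definition P_locally_bounded_on_slices (Omega : ncset) (K : nckernel) : Prop :=
  forall n m (Z DZ : 'M[V]_n) (W DW : 'M[V]_m) P, Omega n Z -> Omega m W ->
    exists e : R, [/\ 0 < e, slice_in Omega Z DZ e, slice_in Omega W DW e &
      bounded_disc e (fun t => opnorm (K n m (slice Z DZ t) (slice W DW t) P))].

(* A is embedded in L(E) by the isometric representation pi; this is what
   provides the norms of matrices over A. *)
Context (E : hilbertType R) (pi : A -> E -> E).

Definition enorm_alg m (u : A ^ m) : \bar R := os_norm (os_alg_col pi m) u.

Definition evnorm m (T : A ^ m -> Y ^ m) : \bar R :=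
  map_norm (@enorm_alg m) (@ehnorm R (Y ^ m)%type) T.

Definition evcbnorm m (T : A ^ m -> Y ^ m) : \bar R :=
  cbnorm (os_alg_col pi m) (os_column (Y ^ m)%type) T.

Definition kercbnorm n m (T : 'M[A]_(n, m) -> Y ^ m -> Y ^ n) : \bar R :=
  cbnorm (os_alg_mx pi n m) (os_op (Y ^ m)%type (Y ^ n)%type) T.

(* cb version of local boundedness on slices, the values K(Z, W) being normed
   as maps from A^(n x m) to L(Y^m, Y^n). *)
Definition cb_locally_bounded_on_slices (Omega : ncset) (K : nckernel) : Prop :=
  forall n m (Z DZ : 'M[V]_n) (W DW : 'M[V]_m), Omega n Z -> Omega m W ->
    exists e : R, [/\ 0 < e, slice_in Omega Z DZ e, slice_in Omega W DW e &
      bounded_disc e (fun t => kercbnorm (K n m (slice Z DZ t) (slice W DW t)))].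

(* H as a space of nc functions on Omega: ev f is the function f. *)
Definition nc_function_space (Omega : ncset) (H : hilbertType R)
    (ev : H -> ncmap A Y) : Prop :=
  [/\ forall f, nc_function enorm_alg (fun n => @ehnorm R (Y ^ n)%type) Omega
        (ev f),
      forall n (Z : 'M[V]_n) u c f g, Omega n Z ->
        ev (c *: f + g) n Z u = c *: ev f n Z u + ev g n Z u &
      forall f g, (forall n (Z : 'M[V]_n), Omega n Z -> ev f n Z =1 ev g n Z) ->
        f = g].

Definition nc_functional_hilbert (Omega : ncset) (H : hilbertType R)
    (ev : H -> ncmap A Y) (sigma : A -> H -> H) : Prop :=
  [/\ nc_function_space Omega ev,
      forall m (W : 'M[V]_m), Omega m W ->
        exists M : R, forall f, (evnorm (ev f m W) <= (M * hnorm f)%:E)%E,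
      star_rep sigma &
      forall a f m (W : 'M[V]_m) u, Omega m W ->
        ev (sigma a f) m W u = ev f m W (col_mulr u a)].

Definition is_kernel_element (Omega : ncset) (H : hilbertType R)
    (ev : H -> ncmap A Y)
    (K : nckernel) m (W : 'M[V]_m) (v : 'rV[A]_m)
    (y : Y ^ m) (k : H) : Prop :=
  forall n (Z : 'M[V]_n) (u : A ^ n), Omega n Z ->
    ev k n Z u = K n m Z W (mx_of_col u *m v) y.

Definition is_HK (Omega : ncset) (H : hilbertType R)
    (ev : H -> ncmap A Y) (sigma : A -> H -> H) (K : nckernel) : Prop :=
  nc_function_space Omega ev /\
  [/\ forall m (W : 'M[V]_m) v y, Omega m W ->
        exists k, is_kernel_element Omega ev K W v y k,
      forall m (W : 'M[V]_m) v y k, Omega m W -> is_kernel_element Omega ev K W v y k ->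
        forall f, inner (ev f m W (col_star v)) y = inner f k,
      star_rep sigma &
      forall a f m (W : 'M[V]_m) v, Omega m W ->
        ev (sigma a f) m W (col_star v) = ev f m W (col_mulr (col_star v) a)].

Definition kolmogorov (Omega : ncset) (K : nckernel)
    (X : hilbertType R) (sigmaX : A -> X -> X) (H : ncmap X Y) : Prop :=
  [/\ star_rep sigmaX,
      nc_function (fun n => @ehnorm R (X ^ n)%type)
        (fun n => @ehnorm R (Y ^ n)%type) Omega H &
      forall n m (Z : 'M[V]_n) (W : 'M[V]_m) P y, Omega n Z -> Omega m W ->
        K n m Z W P y =
        H n Z (op_of_mx (map_mx sigmaX P) (adjoint (H m W) y))].

Definition minimal_kolmogorov (Omega : ncset) (K : nckernel)
    (X : hilbertType R) (sigmaX : A -> X -> X) (H : ncmap X Y) : Prop :=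
  kolmogorov Omega K sigmaX H /\
  dense (lin_span [set x : X | exists m (W : 'M[V]_m) (v : 'rV[A]_m)
      (y : Y ^ m), Omega m W /\ x = op_of_mx (map_mx sigmaX v) (adjoint (H m W) y) 0]).

End nc.

(* Main.v *)
(* Let k_j = k_(Z,e_j,y) be the kernel elements of H(K) attached to the unit rows.
   Through the representation sigma they determine everything:
     <f(Z)(u), y> = sum_j <sigma(u_j) f, k_(Z,e_j,y)>,
     <K(Z,W)(P) y, x> = sum_(i,j) <sigma(P_ij) k_(W,e_j,y), k_(Z,e_i,x)>.
   In particular sum_j |k_(Z,e_j,y)|^2 = <K(Z,Z)(1) y, y>, and since sigma is
   completely contractive, all the cb-norms are controlled by |K(Z,Z)(1)|.
   Conversely, if every f in H is bounded on a slice, then the k_(Z,e_j,y), for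
   Z on the slice and |y| <= 1, are weakly bounded in H, hence bounded by the
   uniform boundedness principle, and so is K(Z,Z)(1). *)

Require Import Defs.
From mathcomp Require Import all_boot all_order all_algebra.
From mathcomp Require Import complex.
From mathcomp Require Import all_classical all_reals all_analysis.
From mathcomp Require Import ring lra.

Set Implicit Arguments.
Unset Strict Implicit.
Unset Printing Implicit Defensive.

Import Order.TTheory GRing.Theory Num.Theory.

Local Open Scope classical_set_scope.
Local Open Scope ring_scope.

(** The obstacle is the complete contractivity of [sigma]. Matrices over A are normed only through
    [pi], which is assumed isometric on A alone, so nothing is known in advance about how [sigma]
    and [pi] compare on matrices. On A itself, a Neumann series shows that [sigma] does not increase
    norms. Comparing matrices entry by entry then costs a factor depending on their size; passing
    from P to P*P replaces such a factor by its square root, and iteration brings it down to 1.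

    The remaining bounds are by duality. The sum of squares S of a family of values y_i is a pairing
    with the kernel elements of the y_i themselves, whose squares sum to at most M S, so one factor
    S cancels. Bounds are therefore kept on squares, over arbitrary finite index types, and one
    computation serves the norm and every matrix level of the cb-norm. *)

Lemma Re_conj (R : realType) (a : R[i]) : complex.Re (Num.conj a) = complex.Re a.
Proof. by case: a. Qed.

Lemma Re_realM (R : realType) (r : R) (a : R[i]) :
  complex.Re (r%:C%C * a) = r * complex.Re a.
Proof. by case: a => a b /=; rewrite mul0r subr0. Qed.

Lemma ReD (R : realType) (a b : R[i]) :
  complex.Re (a + b) = complex.Re a + complex.Re b.
Proof. by case: a; case: b. Qed.

Lemma ReN (R : realType) (a : R[i]) : complex.Re (- a) = - complex.Re a.
Proof. by case: a. Qed.

Lemma Re_sum (R : realType) I (s : seq I) (F : I -> R[i]) :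
  complex.Re (\sum_(i <- s) F i) = \sum_(i <- s) complex.Re (F i).
Proof. by rewrite (big_morph _ (@ReD R) (erefl : complex.Re 0 = 0)). Qed.

(** * Real part of the inner product and the Cauchy-Schwarz inequality *)

Section real_inner_product.
Context (R : realType) (X : preHilbertType R).
Implicit Types (x y z : X) (r : R).

Definition rinner x y : R := complex.Re (inner x y).

Lemma rinnerDl x y z : rinner (x + y) z = rinner x z + rinner y z.
Proof. by rewrite /rinner linearDl ReD. Qed.

Lemma rinnerZl r x y : rinner (r%:C%C *: x) y = r * rinner x y.
Proof.
by rewrite /rinner linearZl_LR Re_realM.
Qed.

Lemma rinnerC x y : rinner x y = rinner y x.
Proof.
rewrite /rinner (hermC inner) expr0 mul1r.
exact: Re_conj.
Qed.

Lemma rinnerDr x y z : rinner x (y + z) = rinner x y + rinner x z.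
Proof. by rewrite rinnerC rinnerDl !(rinnerC x). Qed.

Lemma rinnerZr r x y : rinner x (r%:C%C *: y) = r * rinner x y.
Proof. by rewrite rinnerC rinnerZl rinnerC. Qed.

Lemma rinner0l x : rinner 0 x = 0.
Proof. by rewrite /rinner linear0l. Qed.

Lemma rinner0r x : rinner x 0 = 0.
Proof. by rewrite rinnerC rinner0l. Qed.

Lemma rinnerNl x y : rinner (- x) y = - rinner x y.
Proof. by rewrite /rinner linearNl ReN. Qed.

Lemma rinnerNr x y : rinner x (- y) = - rinner x y.
Proof. by rewrite rinnerC rinnerNl rinnerC. Qed.

Lemma rinner_suml I (s : seq I) (F : I -> X) y :
  rinner (\sum_(i <- s) F i) y = \sum_(i <- s) rinner (F i) y.
Proof. by rewrite /rinner linear_sumlz Re_sum. Qed.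

Lemma inner_real x : inner x x = (rinner x x)%:C%C.
Proof.
rewrite /rinner; have := dnorm_ge0 inner x.
by case: (inner x x) => a b; rewrite lecE /= => /andP[/eqP -> _].
Qed.

Lemma rinner_ge0 x : 0 <= rinner x x.
Proof. by rewrite -lecR -inner_real dnorm_ge0. Qed.

Lemma hnorm_ge0 x : 0 <= hnorm x.
Proof. exact: sqrtr_ge0. Qed.

Lemma sqr_hnorm x : hnorm x ^+ 2 = rinner x x.
Proof. by rewrite sqr_sqrtr ?rinner_ge0. Qed.

Lemma hnorm0_eq0 x : hnorm x = 0 -> x = 0.
Proof.
move=> x0; apply/eqP; rewrite -(dnorm_eq0 inner) inner_real -sqr_hnorm x0.
by rewrite expr0n.
Qed.

Lemma hnorm0 : hnorm (0 : X) = 0.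
Proof. by rewrite /hnorm linear0l /= sqrtr0. Qed.

Lemma hnormZ (c : R[i]) x : hnorm (c *: x) = complex.Re `|c| * hnorm x.
Proof.
rewrite /hnorm linearZl_LR linearZr_LR /= mulrA -normCK inner_real normc_def.
rewrite -!rmorphXn -rmorphM /= sqrtrM ?exprn_ge0 ?sqrtr_ge0// sqrtr_sqr.
by case: c => a b; rewrite ger0_norm ?sqrtr_ge0.
Qed.

Lemma hnormZr r x : hnorm (r%:C%C *: x) = `|r| * hnorm x.
Proof. by rewrite hnormZ normc_def /= expr0n addr0 sqrtr_sqr. Qed.

Lemma cauchy_schwarz x y : rinner x y <= hnorm x * hnorm y.
Proof.
have [y0|y0] := eqVneq (hnorm y) 0.
  by rewrite y0 (hnorm0_eq0 y0) rinner0r mulr0.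
(* The square expands to 2 |x| |y| (|x| |y| - <x,y>), whose first factor is positive once the zero
   cases are removed. *)
have : 0 <= rinner ((hnorm y)%:C%C *: x - (hnorm x)%:C%C *: y)
              ((hnorm y)%:C%C *: x - (hnorm x)%:C%C *: y) by exact: rinner_ge0.
rewrite !(rinnerDl, rinnerDr, rinnerNl, rinnerNr, rinnerZl, rinnerZr).
rewrite -!sqr_hnorm (rinnerC y x).
have [x0|x0] := eqVneq (hnorm x) 0.
  by move=> _; rewrite x0 (hnorm0_eq0 x0) rinner0l mul0r.
have px : 0 < hnorm x by rewrite lt_def x0 hnorm_ge0.
have py : 0 < hnorm y by rewrite lt_def y0 hnorm_ge0.
set s := hnorm x; set t := hnorm y; set p := rinner x y => H.
have : 0 <= (2 * (s * t)) * (s * t - p) by apply: le_trans H _; lra.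
by rewrite pmulr_rge0 ?subr_ge0 ?mulr_gt0.
Qed.

Lemma cauchy_schwarz_abs x y : `|rinner x y| <= hnorm x * hnorm y.
Proof.
rewrite ler_norml cauchy_schwarz andbT lerNl -rinnerNl.
apply: le_trans (cauchy_schwarz _ _) _.
by rewrite -scaleN1r -[-1](rmorphN1 (real_complex R)) hnormZr normrN normr1 mul1r.
Qed.

Lemma hnorm_le_rinner x r : (forall y, hnorm y <= 1 -> rinner x y <= r) -> hnorm x <= r.
Proof.
move=> H; have [x0|x0] := eqVneq (hnorm x) 0.
  by rewrite x0 -(rinner0r x) H// hnorm0.
have xp : 0 < hnorm x by rewrite lt_def x0 hnorm_ge0.
have := H ((hnorm x)^-1%:C%C *: x); rewrite hnormZr rinnerZr -sqr_hnorm.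
by rewrite ger0_norm ?invr_ge0 ?hnorm_ge0// mulVf// expr2 mulKf//; exact.
Qed.

Lemma hnormD x y : hnorm (x + y) <= hnorm x + hnorm y.
Proof.
apply: hnorm_le_rinner => z z1; rewrite rinnerDl lerD//;
  by apply: le_trans (cauchy_schwarz _ _) _; rewrite ler_piMr ?hnorm_ge0.
Qed.

Lemma hnormN x : hnorm (- x) = hnorm x.
Proof.
by rewrite -scaleN1r -[-1](rmorphN1 (real_complex R)) hnormZr normrN normr1 mul1r.
Qed.

Lemma hnorm_sum I (s : seq I) (F : I -> X) :
  hnorm (\sum_(i <- s) F i) <= \sum_(i <- s) hnorm (F i).
Proof.
elim/big_ind2: _ => [|x1 a x2 b H1 H2|//]; first by rewrite hnorm0.
by apply: le_trans (hnormD _ _) _; rewrite lerD.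
Qed.

End real_inner_product.

(** * Sums of squares of finite families *)

Section square_sums.
Context (R : realType) (X : preHilbertType R).

(** Arbitrary finite index types, rather than columns, let the pairs (block, entry) of a matrix of
    matrices serve directly as indices. *)
Definition sqsum (I : finType) (x : I -> X) : R := \sum_i hnorm (x i) ^+ 2.

Lemma sqsum_ge0 (I : finType) (x : I -> X) : 0 <= sqsum x.
Proof. by apply: sumr_ge0 => i _; rewrite sqr_ge0. Qed.

Lemma hnorm_le_sqsum (I : finType) (x : I -> X) i : hnorm (x i) ^+ 2 <= sqsum x.
Proof.
by rewrite /sqsum (bigD1 i)//= ler_wpDr// sumr_ge0// => j _; rewrite sqr_ge0.
Qed.

Lemma rinner_col n (x y : (X ^ n)%type) : rinner x y = \sum_i rinner (x i) (y i).
Proof. exact: Re_sum. Qed.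

Lemma sqr_hnorm_col n (x : (X ^ n)%type) : hnorm x ^+ 2 = sqsum x.
Proof.
by rewrite sqr_hnorm rinner_col; apply: eq_bigr => i _; rewrite sqr_hnorm.
Qed.

Lemma cauchy_schwarz_sum (I : finType) (x y : I -> X) :
  (\sum_i rinner (x i) (y i)) ^+ 2 <= sqsum x * sqsum y.
Proof.
(* Enumerating [I] turns a family into a column, where the claim is Cauchy-Schwarz for a single
   inner product. *)
pose c (z : I -> X) : (X ^ #|I|)%type := [ffun k => z (enum_val k)].
have E z z' : \sum_i rinner (z i) (z' i) = rinner (c z) (c z').
  rewrite rinner_col (eq_bigl (mem I)) // big_enum_val.
  by apply: eq_bigr => i _; rewrite !ffunE.
have N z : sqsum z = hnorm (c z) ^+ 2.
  by rewrite sqr_hnorm -E; apply: eq_bigr => i _; rewrite sqr_hnorm.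
rewrite E !N -exprMn -real_normK ?num_real// ler_sqr ?nnegrE ?mulr_ge0 ?hnorm_ge0//.
exact: cauchy_schwarz_abs.
Qed.

End square_sums.

(** * Consequences of completeness: uniform boundedness and Riesz representation *)

Section completeness.
Context (R : realType) (H : hilbertType R).

Lemma norm_hnorm (x : H) : `|x| = (hnorm x)%:C%C :> R[i].
Proof.
have : `|x| ^+ 2 = (hnorm x)%:C%C ^+ 2.
  by rewrite -inner_norm inner_real -sqr_hnorm rmorphXn.
move/eqP; rewrite eqrXn2 ?normr_ge0// ?lecR ?hnorm_ge0//.
by move/eqP.
Qed.

(** The limit inherits the rate [d]; both applications need this explicit error and not just
    convergence. *)
Lemma hilbert_cauchy_lim (u : nat -> H) (d : nat -> R) :
  (forall n m, (n <= m)%N -> hnorm (u m - u n) <= d n) ->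
  (forall e : R, 0 < e -> exists n, d n < e) ->
  exists l, forall n, hnorm (l - u n) <= d n.
Proof.
move=> ud d0.
have cu : cvgn u.
  apply/cauchy_cvgP/cauchyP => e e0.
  have eR : e = (complex.Re e)%:C%C by rewrite RRe_real ?gtr0_real.
  have [n dn] : exists n, d n < complex.Re e by apply: d0; rewrite -ltcR -eR.
  exists (u n); exists n => // m /= nm.
  rewrite -ball_normE /= distrC norm_hnorm eR ltcR.
  exact: le_lt_trans (ud _ _ nm) dn.
exists (limn u) => n; rewrite leNgt; apply/negP => lt_d.
pose e := hnorm (limn u - u n) - d n.
have e0 : 0 < e by rewrite subr_gt0.
have /cvgrPdist_lt /(_ e%:C%C) : u @ \oo --> limn u by [].
rewrite ltcR => /(_ e0) [N _ /(_ (maxn N n) (leq_maxl _ _))] /=.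
rewrite norm_hnorm ltcR => lt_e.
have := hnormD (limn u - u (maxn N n)) (u (maxn N n) - u n).
rewrite addrA subrK; have := ud _ _ (leq_maxr N n).
rewrite /e in lt_e; lra.
Qed.

(* Each vector of S is tested against one more signed step of length 3^-n,
   the sign being chosen so that the pairing with it does not cancel. *)
Lemma uniform_boundedness (S : set H) :
  (forall x, exists c, forall g, S g -> rinner x g <= c) ->
  exists c, forall g, S g -> hnorm g <= c.
Proof.
move=> Sw; apply: contrapT => unb.
have large n : exists g, S g /\ n%:R * 3 ^+ n * 3 < hnorm g.
  apply: contrapT => no; apply: unb; exists (n%:R * 3 ^+ n * 3) => g Sg.
  by rewrite leNgt; apply/negP => lt_g; apply: no; exists g.
have [g gP] := choice large.
pose step n x : H := (3 ^- n / hnorm (g n))%:C%C *: x.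
have {}large n : 0 < hnorm (g n).
  by apply: le_lt_trans (gP n).2; rewrite !mulr_ge0 ?exprn_ge0.
have stepN n : hnorm (step n (g n)) = 3 ^- n.
  by rewrite hnormZr ger0_norm ?divfK ?gt_eqF// divr_ge0 ?hnorm_ge0.
have next n x : exists y, hnorm (y - x) <= 3 ^- n /\
    3 ^- n * hnorm (g n) <= `|rinner y (g n)|.
  have E : rinner (step n (g n)) (g n) = 3 ^- n * hnorm (g n).
    by rewrite rinnerZl -sqr_hnorm expr2 mulrA divfK ?gt_eqF.
  have p0 : 0 <= 3 ^- n * hnorm (g n) by rewrite mulr_ge0 ?hnorm_ge0// invr_ge0 exprn_ge0.
  have [x0|x0] := leP 0 (rinner x (g n)).
    exists (x + step n (g n)); rewrite addrAC subrr add0r stepN; split=> //.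
    by rewrite rinnerDl E ger0_norm ?addr_ge0// lerDr.
  exists (x - step n (g n)); rewrite addrAC subrr add0r hnormN stepN; split=> //.
  by rewrite rinnerDl rinnerNl E ltr0_norm ?opprD ?opprK ?lerDr; lra.
have [nx nxP] := choice (fun p : nat * H => next p.1 p.2).
pose u := fix u n : H := if n is n'.+1 then nx (n, u n') else 0.
have uS n : hnorm (u n.+1 - u n) <= 3 ^- n.+1 := (nxP (n.+1, u n)).1.
have t3 n : 3 ^- n.+1 = 3 ^- n / 3 :> R by rewrite exprSr invfM mulrC.
(* The steps after the n-th have total length 3^-(n+1) + 3^-(n+2) + ... = 3^-n / 2, half of the n-th
   one, so they cannot undo the pairing of [u n] with [g n]. *)
have u_cauchy n m : (n <= m)%N -> hnorm (u m - u n) <= 3 ^- n / 2.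
  move=> nm; suff : hnorm (u m - u n) <= 3 ^- n / 2 - 3 ^- m / 2.
    by move/le_trans; apply; rewrite gerBl divr_ge0// invr_ge0 exprn_ge0.
  elim: m nm => [|m IH]; first by rewrite leqn0 => /eqP ->; rewrite !subrr hnorm0.
  rewrite leq_eqVlt => /orP[/eqP ->|]; first by rewrite !subrr hnorm0.
  rewrite ltnS => /IH {}IH; have := hnormD (u m.+1 - u m) (u m - u n).
  by rewrite addrA subrK; have := uS m; rewrite t3; lra.
have [//|l lP] := hilbert_cauchy_lim u_cauchy.
  move=> e e0; exists (Num.truncn e^-1).+1.
  have lt_e : e^-1 < (Num.truncn e^-1).+1%:R by exact: truncnS_gt.
  have : (Num.truncn e^-1).+1%:R <= 3 ^+ (Num.truncn e^-1).+1 :> R.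
    by rewrite -natrX ler_nat ltnW// ltn_expl.
  move=> /(lt_le_trans lt_e) lt_3; have : 3 ^- (Num.truncn e^-1).+1 < e.
    by rewrite -[ltRHS]invrK ltf_pV2 ?posrE ?invr_gt0 ?exprn_gt0.
  by have := e0; lra.
(* [Sw] bounds pairings from one side only; using it at [l] and at [- l] bounds the absolute
   value. *)
have [c cP] := Sw l; have [c' cP'] := Sw (- l).
(* For this n, q = 3^-n |g n| is at least 3n, and |<l, g n>| is at least q - q/2 >= 3n/2, beyond the
   bound |c| + |c'| < n. *)
pose n := (Num.truncn (`|c| + `|c'|)).+1.
have : `|rinner l (g n)| <= `|c| + `|c'|.
  have := cP _ (gP n).1; have := cP' _ (gP n).1; rewrite rinnerNl ler_norml.
  have := ler_norm c; have := ler_norm c'.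
  by have := normr_ge0 c; have := normr_ge0 c'; lra.
have lt_n : `|c| + `|c'| < n%:R by exact: truncnS_gt.
have un : 3 ^- n * hnorm (g n) <= `|rinner (u n) (g n)| := (nxP (n, u n.-1)).2.
have close : `|rinner (l - u n) (g n)| <= 3 ^- n / 2 * hnorm (g n).
  by apply: le_trans (cauchy_schwarz_abs _ _) _; rewrite ler_wpM2r ?hnorm_ge0.
have : `|rinner (u n) (g n)| <= `|rinner l (g n)| + `|rinner (l - u n) (g n)|.
  rewrite rinnerDl rinnerNl [in leRHS]distrC.
  by apply: le_trans (ler_normD _ _); rewrite addrC subrK.
have : n%:R * 3 <= 3 ^- n * hnorm (g n).
  rewrite ler_pdivlMl ?exprn_gt0// mulrA [_ * n%:R]mulrC ltW//; exact: (gP n).2.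
have := ler0n R n.
lra.
Qed.

(** Direct method: a point where |x|^2 - 2 Re f(x) is within d^2 of its infimum represents Re f up
    to an error d, and such points converge as d tends to 0. The imaginary part follows from Im f(x)
    = - Re f(i x). *)
Lemma riesz (f : H -> R[i]) (c : R) : (forall a x y, f (a *: x + y) = a * f x + f y) ->
  (forall x, complex.Re (f x) <= c * hnorm x) ->
  exists z, forall x, f x = inner x z.
Proof.
move=> lf fc; pose p x := complex.Re (f x).
have f0 : f 0 = 0 by have := lf (-1) 0 0; rewrite scaler0 addr0 mulN1r addNr.
have fZ a x : f (a *: x) = a * f x by rewrite -[a *: x]addr0 lf f0 addr0.
have fD x y : f (x + y) = f x + f y by rewrite -[x]scale1r lf mul1r scale1r.
have pD x y : p (x + y) = p x + p y by rewrite /p fD ReD.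
have pZ (r : R) x : p (r%:C%C *: x) = r * p x by rewrite /p fZ Re_realM.
have pN x : p (- x) = - p x.
  by rewrite -scaleN1r -[-1](rmorphN1 (real_complex R)) pZ mulN1r.
pose J x := hnorm x ^+ 2 - 2 * p x.
(* Completing the square: |x|^2 - 2 c |x| >= - c^2. *)
have J_lb x : - c ^+ 2 <= J x.
  by rewrite /J; have := fc x; rewrite -/(p x); have := sqr_ge0 (hnorm x - c); nra.
have almost d : 0 < d -> exists u, forall x, `|rinner u x - p x| <= d * hnorm x.
  move=> d0; pose D := range J.
  have hi : has_inf D.
    by split; [exists (J 0), 0 | exists (- c ^+ 2) => _ [x _ <-]].
  have [_ [u _ <-] uP] := inf_adherent (exprn_gt0 2 d0) hi.
  have Ju x : J u - d ^+ 2 <= J x.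
    rewrite lerBlDr; apply: le_trans (ltW uP) _; rewrite lerD2r.
    by apply: ge_inf; [exact: hi.2 | exists x].
  exists u => x; have [x0|x0] := eqVneq (hnorm x) 0.
    by rewrite x0 (hnorm0_eq0 x0) rinner0r /p f0 /= subrr normr0 mulr0.
  have xp : 0 < hnorm x by rewrite lt_def x0 hnorm_ge0.
  have test s : 0 <= d ^+ 2 + 2 * s * (rinner u x - p x) + s ^+ 2 * hnorm x ^+ 2.
    have := Ju (u + s%:C%C *: x); rewrite /J pD pZ !sqr_hnorm.
    rewrite !(rinnerDl, rinnerDr, rinnerZl, rinnerZr) (rinnerC x u); lra.
  have sq : (d / hnorm x) * hnorm x = d by rewrite divfK.
  set r := rinner u x - p x in test *.
  (* These s balance the two error terms of [test], s^2 |x|^2 = d^2; the two signs bound [r] from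
     both sides. *)
  have T1 := test (d / hnorm x); have T2 := test (- (d / hnorm x)).
  rewrite sqrrN -!exprMn sq in T1 T2.
  have key s : 0 <= d ^+ 2 + 2 * s * r + d ^+ 2 -> s * hnorm x = d -> - r <= d * hnorm x.
    move=> h sx; have := mulr_ge0 (ltW xp) h.
    have -> : hnorm x * (d ^+ 2 + 2 * s * r + d ^+ 2) = (2 * d) * (d * hnorm x + r).
      by rewrite -sx; ring.
    by rewrite pmulr_rge0 ?mulr_gt0//; lra.
  have key' s : 0 <= d ^+ 2 + 2 * - s * r + d ^+ 2 -> s * hnorm x = d -> r <= d * hnorm x.
    move=> h sx; have := mulr_ge0 (ltW xp) h.
    have -> : hnorm x * (d ^+ 2 + 2 * - s * r + d ^+ 2) = (2 * d) * (d * hnorm x - r).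
      by rewrite -sx; ring.
    by rewrite pmulr_rge0 ?mulr_gt0//; lra.
  by rewrite ler_norml (key' _ T2 sq) andbT lerNl (key _ T1 sq).
pose e n : R := n.+1%:R^-1.
have e0 n : 0 < e n by rewrite invr_gt0.
have [u uP] := choice (fun n => almost (e n) (e0 n)).
have e_small t : 0 < t -> exists n, e n < t.
  move=> t0; exists (Num.truncn t^-1); rewrite -[ltRHS]invrK ltf_pV2 ?posrE ?invr_gt0//.
  exact: truncnS_gt.
have [||l lP] := @hilbert_cauchy_lim u (fun n => 2 * e n).
- move=> n m nm; apply: hnorm_le_rinner => x x1.
  have := uP n x; have := uP m x; have : e m <= e n.
    by rewrite lef_pV2 ?posrE// ler_nat.
  have := e0 m; have := hnorm_ge0 x; rewrite rinnerDl rinnerNl !ler_norml.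
  by move=> *; nra.
- by move=> t t0; have [n nt] := e_small (t / 2) (divr_gt0 t0 (ltr0n _ 2)); exists n; lra.
have pl x : p x = rinner x l.
  apply/eqP; rewrite -subr_eq0 -normr_le0 leNgt; apply/negP => r0.
  (* The errors add up to 3 |x| e_n; the added 1 keeps the denominator positive for x = 0. *)
  have [n nt] := e_small (`|p x - rinner x l| / (3 * hnorm x + 1))
    (divr_gt0 r0 (ltr_wpDl (mulr_ge0 (ler0n _ 3) (hnorm_ge0 x)) ltr01)).
  have := uP n x; have := cauchy_schwarz_abs (l - u n) x.
  have := ler_wpM2r (hnorm_ge0 x) (lP n).
  have := ler_normD (rinner (l - u n) x) (rinner (u n) x - p x).
  rewrite {1}rinnerDl rinnerNl addrA subrK (rinnerC l) (distrC (rinner x l)).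
  move: nt; rewrite ltr_pdivlMr ?ltr_wpDl ?mulr_ge0 ?hnorm_ge0//.
  have := e0 n; lra.
have Re_i (a : R[i]) : complex.Re ('i%C * a) = - complex.Im a.
  by case: a => a b /=; ring.
exists l => x; apply/eqP.
rewrite eq_complex -[complex.Re (inner x l)]/(rinner x l) -pl eqxx /=.
by rewrite -eqr_opp -!Re_i -fZ -linearZl_LR -/(p _) pl.
Qed.

End completeness.

(** * Operator norms and adjoints *)

Section operator_bounds.
Context (R : realType).

Lemma map_norm_le (S T : Type) (nS : S -> \bar R) (nT : T -> \bar R) (phi : S -> T)
    (c : \bar R) :
  (forall s, (nS s <= 1)%E -> (nT (phi s) <= c)%E) -> (map_norm nS nT phi <= c)%E.
Proof. by move=> H; apply: ge_ereal_sup => _ [s /= s1 <-]; exact: H. Qed.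

Lemma le_map_norm (S T : Type) (nS : S -> \bar R) (nT : T -> \bar R) (phi : S -> T) s :
  (nS s <= 1)%E -> (nT (phi s) <= map_norm nS nT phi)%E.
Proof. by move=> s1; apply: ereal_sup_ubound; exists s. Qed.

Lemma linear_zero (U W : lmodType R[i]) (T : U -> W) : linear T -> T 0 = 0.
Proof. by move=> lT; have := lT (-1) 0 0; rewrite scaler0 addr0 scaleN1r addNr. Qed.

Lemma opnorm_le (X Y : preHilbertType R) (T : X -> Y) (c : R) : 0 <= c ->
  (forall x, hnorm (T x) <= c * hnorm x) -> (opnorm T <= c%:E)%E.
Proof.
move=> c0 H; apply: map_norm_le => x; rewrite !lee_fin => x1.
by apply: le_trans (H x) _; rewrite ler_piMr.
Qed.

Lemma le_opnorm (X Y : preHilbertType R) (T : X -> Y) (c : R) x :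
  linear T -> (opnorm T <= c%:E)%E -> hnorm (T x) <= c * hnorm x.
Proof.
move=> lT Tc; have T0 := linear_zero lT.
have [x0|x0] := eqVneq (hnorm x) 0.
  by rewrite x0 (hnorm0_eq0 x0) T0 hnorm0 mulr0.
have xp : 0 < hnorm x by rewrite lt_def x0 hnorm_ge0.
have : (ehnorm (T ((hnorm x)^-1%:C%C *: x)) <= c%:E)%E.
  apply: le_trans Tc; apply: le_map_norm.
  by rewrite lee_fin hnormZr ger0_norm ?invr_ge0 ?hnorm_ge0// mulVf.
have := lT (hnorm x)^-1%:C%C x 0; rewrite T0 !addr0 => ->.
rewrite lee_fin hnormZr ger0_norm ?invr_ge0 ?hnorm_ge0//.
by rewrite mulrC ler_pdivrMr.
Qed.

Lemma opnorm_ge0 (X Y : preHilbertType R) (T : X -> Y) : (0 <= opnorm T)%E.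
Proof.
apply: (@le_trans _ _ (ehnorm (T 0))); first by rewrite lee_fin hnorm_ge0.
by apply: le_map_norm; rewrite lee_fin hnorm0.
Qed.

Lemma bounded_op_opnorm (X Y : preHilbertType R) (T : X -> Y) :
  bounded_op T -> exists2 c : R, opnorm T = c%:E & 0 <= c.
Proof.
move=> [_ Tfin]; have T0 := opnorm_ge0 T; exists (fine (opnorm T)); last exact: fine_ge0.
by rewrite fineK// ge0_fin_numE.
Qed.

Lemma linear_big (U W : lmodType R[i]) (T : U -> W) I (s : seq I) (F : I -> U) :
  linear T -> T (\sum_(i <- s) F i) = \sum_(i <- s) T (F i).
Proof.
move=> lT; apply: (big_morph T) => [x y|].
  by have := lT 1 x y; rewrite !scale1r.
exact: linear_zero.
Qed.

Lemma linear_scale (U W : lmodType R[i]) (T : U -> W) c x :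
  linear T -> T (c *: x) = c *: T x.
Proof.
by move=> lT; have := lT c x 0; rewrite (linear_zero lT) !addr0.
Qed.

Definition unit_col (U : nmodType) n (i : 'I_n) (x : U) : (U ^ n)%type :=
  [ffun j => if j == i then x else 0].

Lemma sum_unit_col (U : nmodType) n (x : (U ^ n)%type) :
  x = \sum_i unit_col i (x i).
Proof.
apply/ffunP => j; rewrite sum_ffunE (bigD1 j)//= ffunE eqxx big1 ?addr0// => i ij.
by rewrite ffunE eq_sym (negPf ij).
Qed.

Lemma hnorm_unit_col (X : preHilbertType R) n (i : 'I_n) (x : X) :
  hnorm (unit_col i x) = hnorm x.
Proof.
rewrite /hnorm /inner /= /col_inner (bigD1 i)//= !ffunE eqxx big1 ?addr0// => j ij.
by rewrite ffunE (negPf ij) linear0l.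
Qed.

(** The columns [X ^ n] carry only a pre-Hilbert structure, so Riesz is applied in [X], once per
    coordinate, and the resulting vectors are assembled into a column. *)
Lemma adjointP (X : hilbertType R) (Y : preHilbertType R) n
    (T : (X ^ n)%type -> Y) : bounded_op T ->
  forall x y, inner (T x) y = inner x (adjoint T y).
Proof.
move=> bT x y; have [c Tc c0] := bounded_op_opnorm bT.
suff /xgetPex : exists z, forall x, inner (T x) y = inner x z by exact.
have zP (i : 'I_n) : exists z : X, forall x, inner (T (unit_col i x)) y = inner x z.
  apply: (@riesz _ _ _ (c * hnorm y)) => [a u v|u].
    rewrite -linearZl_LR -linearDl; congr (inner _ _); rewrite -bT.1; congr T.
    by apply/ffunP => j; rewrite !ffunE; case: ifP => // _; rewrite scaler0 addr0.
  apply: le_trans (cauchy_schwarz _ _) _; rewrite mulrAC ler_wpM2r ?hnorm_ge0//.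
  by rewrite -[hnorm u](hnorm_unit_col i); apply: le_opnorm; [exact: bT.1 | rewrite Tc].
have [z zE] := choice zP; exists [ffun i => z i] => {}x.
rewrite {1}[x]sum_unit_col (linear_big _ _ bT.1) linear_sumlz.
apply: eq_bigr => i _.
by rewrite ffunE; exact: zE.
Qed.

End operator_bounds.

(** * Neumann series in a C*-algebra *)

Section neumann.
Import numFieldNormedType.Exports.
Context (R : realType) (A : cstarAlgType R).
Implicit Types a b h : A.

Lemma cnorm0 : cnorm (0 : A) = 0.
Proof. by rewrite -(scale0r 0) cnormZ normr0 /= mul0r. Qed.

Lemma cnormZr (r : R) a : cnorm (r%:C%C *: a) = `|r| * cnorm a.
Proof. by rewrite cnormZ normc_def /= expr0n addr0 sqrtr_sqr. Qed.

Lemma cnormN a : cnorm (- a) = cnorm a.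
Proof.
by rewrite -scaleN1r -[-1](rmorphN1 (real_complex R)) cnormZr normrN normr1 mul1r.
Qed.

Lemma cnorm_ge0 a : 0 <= cnorm a.
Proof.
have := cnormD a (- a); rewrite subrr cnorm0 cnormN; lra.
Qed.

Lemma star1 : star (1 : A) = 1.
Proof. by rewrite -[LHS]mul1r -{1}(starK 1) -starM mul1r starK. Qed.

Lemma star0 : star (0 : A) = 0.
Proof. by apply: (@addIr _ (star 0)); rewrite -starD !add0r. Qed.

Lemma cnorm1_le : cnorm (1 : A) <= 1.
Proof.
have := cnorm_star (1 : A); rewrite star1 mulr1 => E.
by have := cnorm_ge0 1; nra.
Qed.

Lemma cnormX_le a n : cnorm (a ^+ n) <= cnorm a ^+ n.
Proof.
elim: n => [|n IH]; first by rewrite !expr0 cnorm1_le.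
by rewrite !exprS; apply: le_trans (cnormM _ _) _; rewrite ler_wpM2l ?cnorm_ge0.
Qed.

(** The left inverse is the sum of the powers of [h]. Under a representation it bounds |y| by a
    multiple of |y - sigma(h) y|, which is its use in [rep_contractive]. *)
Lemma neumann h : cnorm h < 1 -> exists b, b * (1 - h) = 1.
Proof.
move=> h1; set q := cnorm h in h1; have q0 : 0 <= q by exact: cnorm_ge0.
have qlim : (fun n => q ^+ n) @ \oo --> (0 : R).
  by apply: cvg_expr; rewrite ger0_norm.
pose u n := \sum_(k < n) h ^+ k.
have uM n : u n * (1 - h) = 1 - h ^+ n.
  elim: n => [|n IH]; first by rewrite /u big_ord0 mul0r expr0 subrr.
  by rewrite /u big_ord_recr /= mulrDl IH mulrBr mulr1 -exprSr addrA subrK.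
have uC n m : (n <= m)%N -> (1 - q) * cnorm (u m - u n) <= q ^+ n - q ^+ m.
  elim: m => [|m IH]; first by rewrite leqn0 => /eqP ->; rewrite !subrr cnorm0 mulr0.
  rewrite leq_eqVlt => /orP[/eqP ->|]; first by rewrite !subrr cnorm0 mulr0.
  rewrite ltnS => /IH {}IH; rewrite {1}/u big_ord_recr /= -/(u m) addrAC.
  have : cnorm (u m - u n + h ^+ m) <= cnorm (u m - u n) + q ^+ m.
    by apply: le_trans (cnormD _ _) _; rewrite lerD2l cnormX_le.
  have p1 : 0 <= 1 - q by lra.
  by move/(ler_wpM2l p1); rewrite exprS; lra.
have uC' n m : (n <= m)%N -> (1 - q) * cnorm (u m - u n) <= q ^+ n.
  by move=> /uC /le_trans; apply; rewrite gerBl exprn_ge0.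
have [|l ul] := cnorm_complete u.
  move=> e e0; have /cvgrPdist_lt /(_ (e * (1 - q))) := qlim.
  have p1 : 0 < 1 - q by lra.
  rewrite mulr_gt0// => /(_ isT) [N _ NP]; exists N => m n.
  wlog mn : m n / (m <= n)%N => [wl Nm Nn|Nm _].
    have [mn|/ltnW nm] := leqP m n; first exact: wl.
    by rewrite -cnormN opprB; apply: wl.
  rewrite -cnormN opprB -(ltr_pM2l p1) [ltRHS]mulrC.
  apply: le_lt_trans (uC' _ _ mn) _; have := NP m Nm => /=.
  by rewrite sub0r normrN ger0_norm ?exprn_ge0.
exists l; apply/eqP; rewrite -subr_eq0; apply/eqP/cnorm_eq0.
apply/eqP; rewrite eq_le cnorm_ge0 andbT.
(* The norm of [l * (1 - h) - 1] does not depend on n, yet it is bounded by this null sequence. *)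
have lim0 : (fun n => cnorm (u n - l) * cnorm (1 - h) + q ^+ n) @ \oo --> (0 : R).
  have -> : 0 = 0 * cnorm (1 - h) + 0 :> R by rewrite mul0r addr0.
  by apply: cvgD => //; apply: cvgM => //; exact: cvg_cst.
apply: (cvgr_to_ge lim0); apply: nearW => n /=.
have -> : l * (1 - h) - 1 = - ((u n - l) * (1 - h)) - h ^+ n.
  by rewrite mulrBl uM opprB -addrA opprB [_ - 1 - _]addrAC subrr add0r.
apply: le_trans (cnormD _ _) _; rewrite !cnormN lerD ?cnormX_le//.
exact: cnormM.
Qed.

End neumann.

(** * Representations of A are completely contractive *)

Section representations.
Context (R : realType) (A : cstarAlgType R).

Section one_representation.
Context (H : hilbertType R) (sigma : A -> H -> H).
Hypothesis sR : star_rep sigma.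
Implicit Types (a b : A) (x y : H).

Lemma rep_linear a : linear (sigma a). Proof. by case: sR => /(_ a)[]. Qed.

Lemma repDl a b x : sigma (a + b) x = sigma a x + sigma b x.
Proof. by case: sR => _ /(_ x 1 a b); rewrite !scale1r. Qed.

Lemma repZl c a x : sigma (c *: a) x = c *: sigma a x.
Proof. by case: sR => _ /(_ x) l _ _ _; rewrite (linear_scale c a l). Qed.

Lemma rep0l x : sigma 0 x = 0.
Proof. by rewrite -(scale0r 0) repZl scale0r. Qed.

Lemma rep_suml I (s : seq I) (F : I -> A) x :
  sigma (\sum_(i <- s) F i) x = \sum_(i <- s) sigma (F i) x.
Proof. exact: (big_morph (sigma^~ x) (fun a b => repDl a b x) (rep0l x)). Qed.

Lemma rep1 x : sigma 1 x = x. Proof. by case: sR. Qed.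

Lemma repM a b x : sigma (a * b) x = sigma a (sigma b x). Proof. by case: sR. Qed.

Lemma rinner_rep a x y : rinner (sigma a x) y = rinner x (sigma (star a) y).
Proof. by case: sR => _ _ _ _ e; rewrite /rinner e. Qed.

(** For z = [sigma (star a) x], |z|^2 = <x, sigma(a) z> <= c |x| |z|. *)
Lemma rep_adjoint_bound a (c : R) : 0 <= c ->
  (forall x, hnorm (sigma a x) <= c * hnorm x) ->
  forall x, hnorm (sigma (star a) x) <= c * hnorm x.
Proof.
move=> c0 sc x; set z := sigma (star a) x.
have : hnorm z ^+ 2 <= hnorm x * (c * hnorm z).
  rewrite sqr_hnorm {2}/z -[a in star a]starK -rinner_rep starK rinnerC.
  by apply: le_trans (cauchy_schwarz _ _) _; rewrite ler_wpM2l ?hnorm_ge0.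
have [->|z0] := eqVneq (hnorm z) 0; first by rewrite mulr_ge0 ?hnorm_ge0.
by rewrite mulrCA mulrA expr2 ler_pM2r ?lt_def ?z0 ?hnorm_ge0.
Qed.

(* If the norm N of sigma a exceeded that of a, then 1 - N^-2 a*a would have an
   inverse, which is impossible since the vectors on which sigma a almost
   attains N are almost killed by 1 - N^-2 sigma (a*a). *)
Lemma rep_contractive a x : hnorm (sigma a x) <= cnorm a * hnorm x.
Proof.
have bd b : bounded_op (sigma b) by case: sR => /(_ b).
have [N sN N0] := bounded_op_opnorm (bd a).
have sa y : hnorm (sigma a y) <= N * hnorm y.
  by apply: le_opnorm; [exact: rep_linear | rewrite sN].
have Nmin c : 0 <= c -> (forall y, hnorm (sigma a y) <= c * hnorm y) -> N <= c.
  by move=> c0 /(opnorm_le c0); rewrite sN lee_fin.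
have [Na|aN] := leP N (cnorm a).
  by apply: le_trans (sa x) _; rewrite ler_wpM2r ?hnorm_ge0.
have Np : 0 < N by apply: le_lt_trans aN; exact: cnorm_ge0.
(* The norm of [h] is below 1 because |a* a| = |a|^2 < N^2. *)
pose h := (N ^- 2)%:C%C *: (star a * a).
have [b bh] : exists b, b * (1 - h) = 1.
  apply: neumann; rewrite cnormZr cnorm_star ger0_norm ?invr_ge0 ?sqr_ge0//.
  rewrite mulrC ltr_pdivrMr ?exprn_gt0// mul1r ltr_sqr ?nnegrE ?cnorm_ge0//.
have [B0 sB B00] := bounded_op_opnorm (bd b).
(* Adding 1 ensures B >= 1, so that r = 1 - B^-2 below lies in [0, 1). *)
pose B := B0 + 1; have B1 : 1 <= B by rewrite lerDr.
have sb y : hnorm (sigma b y) <= B * hnorm y.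
  apply: (@le_trans _ _ (B0 * hnorm y)); last by rewrite ler_wpM2r ?hnorm_ge0 ?lerDl.
  by apply: le_opnorm; [exact: rep_linear | rewrite sB].
have upper y : hnorm (y - sigma h y) ^+ 2 <= hnorm y ^+ 2 - N ^- 2 * hnorm (sigma a y) ^+ 2.
  set z := sigma a y; have hz : sigma h y = (N ^- 2)%:C%C *: sigma (star a) z.
    by rewrite repZl repM.
  have yz : rinner y (sigma (star a) z) = hnorm z ^+ 2.
    by rewrite sqr_hnorm -rinner_rep.
  have := rep_adjoint_bound N0 sa z.
  set w := sigma (star a) z in hz yz *.
  rewrite -(@ler_sqr _ (hnorm w)) ?nnegrE ?mulr_ge0 ?hnorm_ge0// exprMn => wN.
  rewrite hz sqr_hnorm !(rinnerDl, rinnerDr, rinnerNl, rinnerNr, rinnerZl, rinnerZr).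
  rewrite (rinnerC w y) yz -!sqr_hnorm.
  have k0 : 0 <= N ^- 2 by rewrite invr_ge0 sqr_ge0.
  have k1 : N ^- 2 * N ^+ 2 = 1 by rewrite mulVf// sqrf_eq0 gt_eqF.
  have := ler_wpM2l (mulr_ge0 k0 k0) wN.
  have -> : N ^- 2 * N ^- 2 * (N ^+ 2 * hnorm z ^+ 2) = N ^- 2 * hnorm z ^+ 2.
    by rewrite mulrA -(mulrA _ _ (N ^+ 2)) k1 mulr1.
  lra.
have lower y : hnorm y ^+ 2 <= B ^+ 2 * hnorm (y - sigma h y) ^+ 2.
  rewrite -exprMn ler_sqr ?nnegrE ?mulr_ge0 ?hnorm_ge0 ?(le_trans ler01)//.
  have -> : hnorm y = hnorm (sigma b (y - sigma h y)).
    have <- : sigma (1 - h) y = y - sigma h y.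
      by rewrite repDl rep1 -scaleN1r repZl scaleN1r.
    by rewrite -repM bh rep1.
  exact: sb.
have B2 : 1 <= B ^+ 2 by rewrite exprn_ege1.
pose r := 1 - B ^- 2.
have r0 : 0 <= r by rewrite subr_ge0 invf_le1 ?(lt_le_trans ltr01).
have r1 : r < 1 by rewrite gtrDl oppr_lt0 invr_gt0 (lt_le_trans ltr01).
(* [lower] and [upper] combine to |sigma(a) y|^2 <= N^2 r |y|^2, against the minimality of N. *)
suff : N <= N * Num.sqrt r.
  rewrite ler_pMr// leNgt => /negP[]; rewrite -[ltRHS]sqrtr1.
  by rewrite ltr_sqrt.
apply: Nmin => [|y]; first by rewrite mulr_ge0 ?sqrtr_ge0.
rewrite -ler_sqr ?nnegrE ?mulr_ge0 ?hnorm_ge0 ?sqrtr_ge0// !exprMn (sqr_sqrtr r0).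
have k0 : 0 < B ^+ 2 by exact: lt_le_trans ltr01 B2.
have := le_trans (lower y) (ler_wpM2l (ltW k0) (upper y)).
rewrite -ler_pdivrMl// => U; rewrite -mulrA -ler_pdivrMl ?exprn_gt0//.
by rewrite /r mulrBl mul1r; lra.
Qed.

Definition rep_mx (I J : finType) (P : I -> J -> A) (x : J -> H) (i : I) : H :=
  \sum_j sigma (P i j) (x j).

(** Here [c] bounds the square of the operator norm of the matrix. *)
Definition rep_mx_bound (I J : finType) (P : I -> J -> A) (c : R) :=
  forall x : J -> H, sqsum (rep_mx P x) <= c * sqsum x.

(** Each of the #|I| rows is a sum of #|J| vectors, whence #|J|^2 after squaring. The dependence on
    the size is removed in [rep_mx_contractive]. *)
Lemma rep_mx_bound_entries (I J : finType) (P : I -> J -> A) (c : R) : 0 <= c ->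
  (forall i j, cnorm (P i j) ^+ 2 <= c) ->
  rep_mx_bound P ((#|I| * #|J| ^ 2)%:R * c).
Proof.
move=> c0 Pc x; have entry i j : hnorm (sigma (P i j) (x j)) <= Num.sqrt (c * sqsum x).
  apply: le_trans (rep_contractive _ _) _.
  rewrite -ler_sqr ?nnegrE ?mulr_ge0 ?cnorm_ge0 ?hnorm_ge0 ?sqrtr_ge0//.
  rewrite exprMn (@sqr_sqrtr _ (c * _)) ?mulr_ge0 ?sqsum_ge0//.
  by rewrite ler_pM ?sqr_ge0 ?Pc ?hnorm_le_sqsum.
have row i : hnorm (rep_mx P x i) ^+ 2 <= #|J|%:R ^+ 2 * (c * sqsum x).
  rewrite -[c * sqsum x]sqr_sqrtr ?mulr_ge0 ?sqsum_ge0// -exprMn.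
  rewrite ler_sqr ?nnegrE ?mulr_ge0 ?hnorm_ge0 ?sqrtr_ge0//.
  apply: le_trans (hnorm_sum _ _) _; rewrite mulr_natl -sumr_const.
  by apply: ler_sum => j _; exact: entry.
apply: le_trans (ler_sum _ (fun i _ => row i)) _.
by rewrite sumr_const -[leLHS]mulr_natl natrM natrX !mulrA.
Qed.

Lemma rep_mx_bounded (I J : finType) (P : I -> J -> A) :
  exists2 c, 0 <= c & rep_mx_bound P c.
Proof.
pose c := \sum_i \sum_j cnorm (P i j) ^+ 2.
have row_ge0 i : 0 <= \sum_j cnorm (P i j) ^+ 2.
  by rewrite sumr_ge0// => j _; rewrite sqr_ge0.
have c0 : 0 <= c by exact: sumr_ge0.
exists ((#|I| * #|J| ^ 2)%:R * c); first by rewrite mulr_ge0.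
apply: rep_mx_bound_entries => // i j.
rewrite /c (bigD1 i)//= (bigD1 j)//= -addrA lerDl addr_ge0 ?sumr_ge0//.
by move=> l _; rewrite sqr_ge0.
Qed.

(** The entries of P* P, a square matrix over [J] whatever the row type of P. *)
Definition adj_sq (I J : finType) (P : I -> J -> A) (j k : J) : A :=
  \sum_i star (P i j) * P i k.

Lemma rinner_adj_sq (I J : finType) (P : I -> J -> A) (x y : J -> H) :
  \sum_i rinner (rep_mx P x i) (rep_mx P y i) =
  \sum_j rinner (x j) (rep_mx (adj_sq P) y j).
Proof.
under eq_bigr do rewrite rinner_suml.
rewrite exchange_big; apply: eq_bigr => j _ /=.
under eq_bigr do rewrite rinner_rep rinnerC.
rewrite -rinner_suml [RHS]rinnerC; congr (rinner _ (x j)).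
rewrite /rep_mx; under [RHS]eq_bigr do rewrite rep_suml.
rewrite exchange_big; apply: eq_bigr => i _ /=.
rewrite (linear_big _ _ (rep_linear _)); apply: eq_bigr => k _.
by rewrite repM.
Qed.

(** |P x|^2 = <x, P*P x> <= |x| |P*P x|. *)
Lemma sqsum_adj_sq (I J : finType) (P : I -> J -> A) (x : J -> H) :
  sqsum (rep_mx P x) ^+ 2 <= sqsum x * sqsum (rep_mx (adj_sq P) x).
Proof.
apply: le_trans (cauchy_schwarz_sum _ _); rewrite -rinner_adj_sq.
by rewrite le_eqVlt; apply/orP; left; apply/eqP; congr (_ ^+ 2);
  apply: eq_bigr => i _; rewrite sqr_hnorm.
Qed.

(** With z = P*P x, |z|^2 = <P z, P x> <= c |z| |x|. *)
Lemma rep_mx_bound_adj_sq (I J : finType) (P : I -> J -> A) (c : R) : 0 <= c ->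
  rep_mx_bound P c -> rep_mx_bound (adj_sq P) (c ^+ 2).
Proof.
move=> c0 Pc x; set z := rep_mx (adj_sq P) x.
have E : sqsum z = \sum_i rinner (rep_mx P z i) (rep_mx P x i).
  by rewrite rinner_adj_sq; apply: eq_bigr => j _; rewrite sqr_hnorm.
have := cauchy_schwarz_sum (rep_mx P z) (rep_mx P x); rewrite -E.
move/le_trans => /(_ _ (ler_pM (sqsum_ge0 _) (sqsum_ge0 _) (Pc z) (Pc x))) H0.
have [->|z0] := eqVneq (sqsum z) 0; first by rewrite mulr_ge0 ?sqr_ge0 ?sqsum_ge0.
have zp : 0 < sqsum z by rewrite lt_def z0 sqsum_ge0.
rewrite -(ler_pM2l zp) -expr2; apply: le_trans H0 _; lra.
Qed.

End one_representation.

Context (E H : hilbertType R) (pi : A -> E -> E) (sigma : A -> H -> H).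
Hypotheses (piR : isometric_rep pi) (sR : star_rep sigma).

(** The isometry of [pi] enters here: testing the matrix on families supported at [j] isolates one
    entry. *)
Lemma cnorm_le_rep_mx (I J : finType) (P : I -> J -> A) (c : R) : 0 <= c ->
  rep_mx_bound pi P c -> forall i j, cnorm (P i j) ^+ 2 <= c.
Proof.
move=> c0 Pc i j; rewrite -(sqr_sqrtr c0) ler_sqr ?nnegrE ?cnorm_ge0 ?sqrtr_ge0//.
rewrite -lee_fin -piR.2; apply: opnorm_le; rewrite ?sqrtr_ge0// => x.
rewrite -ler_sqr ?nnegrE ?mulr_ge0 ?hnorm_ge0 ?sqrtr_ge0// exprMn (sqr_sqrtr c0).
pose d k : E := if k == j then x else 0.
have dE : sqsum d = hnorm x ^+ 2.
  rewrite /sqsum (bigD1 j)//= /d eqxx big1 ?addr0// => k /negPf ->.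
  by rewrite hnorm0 expr0n.
have PdE : rep_mx pi P d i = pi (P i j) x.
  rewrite /rep_mx (bigD1 j)//= /d eqxx big1 ?addr0// => k /negPf ->.
  exact: linear_zero (rep_linear piR.1 _).
by rewrite -dE -PdE; apply: le_trans (Pc d); exact: hnorm_le_sqsum.
Qed.

(* A constant K valid for all square matrices over A, tested on P*P, gives the
   constant sqrt K; so 1 + d yields 1 + d/2, and in the limit 1. *)
Lemma rep_mx_contractive (I J : finType) (P : I -> J -> A) (c : R) : 0 <= c ->
  rep_mx_bound pi P c -> rep_mx_bound sigma P c.
Proof.
move=> c0 Pc.
(* Fixing the index type [J] is enough, since P*P lives on it for every P with columns in [J]; the
   starting constant thus depends on #|J| only. *)
pose valid K := forall (B : J -> J -> A) (b : R), 0 <= b ->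
  rep_mx_bound pi B b -> rep_mx_bound sigma B (K * b).
have improve (I' : finType) (B : I' -> J -> A) (b d : R) : 0 <= b -> 0 <= d ->
    valid (1 + d) -> rep_mx_bound pi B b -> rep_mx_bound sigma B ((1 + d / 2) * b).
  move=> b0 d0 vd Bb x.
  have := vd _ _ (sqr_ge0 b) (rep_mx_bound_adj_sq piR.1 b0 Bb) x.
  move/(ler_wpM2l (sqsum_ge0 x)); move/(le_trans (sqsum_adj_sq sR B x)) => H0.
  have s0 := sqsum_ge0 x.
  rewrite -ler_sqr ?nnegrE ?sqsum_ge0 ?mulr_ge0 ?addr_ge0 ?divr_ge0//.
  apply: le_trans H0 _; rewrite !exprMn.
  have := mulr_ge0 (sqr_ge0 (b * sqsum x)) (sqr_ge0 d); rewrite exprMn; nra.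
(* Entries link the two representations: [pi] bounds them from its matrix norm, and they bound the
   matrix under [sigma]. *)
have valid0 : valid (1 + (#|J| * #|J| ^ 2)%:R).
  move=> B b b0 Bb x; have := rep_mx_bound_entries sR b0 (cnorm_le_rep_mx b0 Bb) x.
  move/le_trans; apply; rewrite ler_wpM2r ?sqsum_ge0// ler_wpM2r// lerDr ler01//.
set K := (_%:R) in valid0.
have validn n : valid (1 + K / 2 ^+ n).
  elim: n => [|n IH]; first by rewrite expr0 divr1.
  move=> B b b0 Bb; rewrite exprSr invfM mulrA; apply: improve => //.
  by rewrite divr_ge0 ?exprn_ge0.
move=> x; apply/ler_addgt0Pr => e e0.
have K0 : 0 <= K by [].
pose T := K * (c * sqsum x).
have T0 : 0 <= T by rewrite !mulr_ge0 ?sqsum_ge0.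
have [n nP] : exists n, T / 2 ^+ n < e.
  exists (Num.truncn (T / e)).+1; rewrite ltr_pdivrMr ?exprn_gt0// mulrC -ltr_pdivrMr//.
  apply: (lt_le_trans (truncnS_gt _)).
  by rewrite -natrX ler_nat ltnW// ltn_expl.
have Kn0 : 0 <= K / 2 ^+ n by rewrite divr_ge0 ?exprn_ge0.
have := improve I P c _ c0 Kn0 (validn n) Pc x; move/le_trans; apply.
have : K / 2 ^+ n * (c * sqsum x) < e by rewrite mulrAC.
have : 0 <= K / 2 ^+ n * (c * sqsum x) by rewrite mulr_ge0 ?mulr_ge0 ?sqsum_ge0.
lra.
Qed.

End representations.

(** * Kernel elements and the estimates they give *)

Section kernel_elements.
Context (R : realType) (V : lmodType R[i]) (Omega : ncset V) (A : cstarAlgType R)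
  (E : hilbertType R) (pi : A -> E -> E) (Y : hilbertType R)
  (K : nckernel V A Y) (H : hilbertType R) (ev : H -> ncmap V A Y)
  (sigma : A -> H -> H).
Hypotheses (cpK : cp_nckernel Omega K) (HK : is_HK pi Omega ev sigma K).

Definition unit_row n (j : 'I_n) : 'rV[A]_n := delta_mx 0 j.

(* y |-> (kernel_elt Z j y)_j is the operator H(Z)^* of the Kolmogorov
   decomposition of K over H(K). *)
Definition kernel_elt n (Z : 'M[V]_n) (j : 'I_n) (y : (Y ^ n)%type) : H :=
  xget 0 [set k | is_kernel_element Omega ev K Z (unit_row j) y k].

Lemma HK_rep : star_rep sigma. Proof. by case: HK => _ []. Qed.

Lemma kernel_eltP n (Z : 'M[V]_n) j y : Omega Z ->
  is_kernel_element Omega ev K Z (unit_row j) y (kernel_elt Z j y).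
Proof.
move=> ZO; case: HK => _ [+ _ _ _] => /(_ _ Z (unit_row j) y ZO) => h.
exact: (xgetPex 0 h).
Qed.

Lemma inner_kernel_elt n (Z : 'M[V]_n) j y f : Omega Z ->
  inner (ev f Z (unit_col j 1)) y = inner f (kernel_elt Z j y).
Proof.
move=> ZO; case: HK => _ [_ + _ _] => /(_ _ Z (unit_row j) y _ ZO (kernel_eltP j y ZO)).
move=> <-; congr (inner (ev f Z _) y); apply/ffunP => k.
by rewrite !ffunE mxE eqxx /=; case: eqP => _; rewrite ?star1 ?star0.
Qed.

(** Every column is the star of a row, so the covariance that [is_HK] states on [col_star v] covers
    all [u]. *)
Lemma ev_rep a f n (Z : 'M[V]_n) u : Omega Z ->
  ev (sigma a f) Z u = ev f Z (col_mulr u a).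
Proof.
move=> ZO; case: HK => _ [_ _ _ /(_ a f _ Z (\row_j star (u j)) ZO)].
suff -> : col_star (\row_j star (u j)) = u by [].
by apply/ffunP => j; rewrite !ffunE mxE starK.
Qed.

Lemma ev_linear f n (Z : 'M[V]_n) : Omega Z -> linear (ev f Z).
Proof. by move=> ZO; case: HK => -[/(_ f)[/(_ _ Z ZO)[]]]. Qed.

Lemma evZ c f n (Z : 'M[V]_n) u : Omega Z -> ev (c *: f) Z u = c *: ev f Z u.
Proof.
move=> ZO; apply: (linear_scale (T := fun g => ev g Z u)) => a g g'.
by case: HK => -[_ + _] _; exact.
Qed.

(** u = sum_j e_j u_j, and f(Z)(e_j u_j) = (sigma(u_j) f)(Z)(e_j). *)
Lemma inner_ev f n (Z : 'M[V]_n) u y : Omega Z ->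
  inner (ev f Z u) y = \sum_j inner (sigma (u j) f) (kernel_elt Z j y).
Proof.
move=> ZO; rewrite {1}[u]sum_unit_col (linear_big _ _ (ev_linear f ZO)) linear_sumlz.
apply: eq_bigr => j _; rewrite -inner_kernel_elt// ev_rep//.
congr (inner (ev f Z _) y); apply/ffunP => k; rewrite !ffunE.
by case: eqP => _; rewrite ?mul1r ?mul0r.
Qed.

Lemma kernel_add n m (Z : 'M[V]_n) (W : 'M[V]_m) P Q y : Omega Z -> Omega W ->
  K Z W (P + Q) y = K Z W P y + K Z W Q y.
Proof.
move=> ZO WO; case: cpK => -[_ /(_ _ _ Z W 1 P Q y ZO WO) + _] _.
rewrite scale1r; suff -> : mx_scale 1 P = P by [].
by apply/matrixP => i j; rewrite mxE scale1r.
Qed.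

Lemma kernel_sum n m (Z : 'M[V]_n) (W : 'M[V]_m) I (s : seq I) F y :
  Omega Z -> Omega W ->
  K Z W (\sum_(i <- s) F i) y = \sum_(i <- s) K Z W (F i) y.
Proof.
move=> ZO WO; apply: (big_morph (fun P => K Z W P y)) => [P Q|].
  exact: kernel_add.
by apply: (@addIr _ (K Z W 0 y)); rewrite -kernel_add// !add0r.
Qed.

Lemma inner_kernel n m (Z : 'M[V]_n) (W : 'M[V]_m) P y x : Omega Z -> Omega W ->
  inner (K Z W P y) x = \sum_i inner (rep_mx sigma P (kernel_elt W ^~ y) i)
                                     (kernel_elt Z i x).
Proof.
move=> ZO WO.
(* Writing the (i, j) part of P as the column e_i P_ij times the row e_j gives the form u v in which
   K(Z,W)(u v) y is the value of a kernel element. *)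
pose e i j : 'M[A]_(n, m) := mx_of_col (col_mulr (unit_col i 1) (P i j)) *m unit_row j.
have PE : P = \sum_i \sum_j e i j.
  apply/matrixP => k l; rewrite summxE (bigD1 k)//= summxE (bigD1 l)//=.
  rewrite big1 => [|j jl]; last first.
    by rewrite /e !mxE big_ord1 !mxE (eq_sym l) (negPf jl) andbF mulr0.
  rewrite big1 => [|i ik]; last first.
    rewrite summxE big1// => j _.
    by rewrite /e !mxE big_ord1 !mxE !ffunE (eq_sym k) (negPf ik) !mul0r.
  by rewrite /e !mxE big_ord1 !mxE !ffunE !eqxx mul1r mulr1 !addr0.
rewrite {1}PE kernel_sum// linear_sumlz; apply: eq_bigr => i _.
rewrite kernel_sum// !linear_sumlz; apply: eq_bigr => j _.
apply: etrans (inner_kernel_elt i x _ ZO).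
by rewrite ev_rep// kernel_eltP.
Qed.

Lemma rinner_kernel n m (Z : 'M[V]_n) (W : 'M[V]_m) P y x : Omega Z -> Omega W ->
  rinner (K Z W P y) x = \sum_i rinner (rep_mx sigma P (kernel_elt W ^~ y) i)
                                      (kernel_elt Z i x).
Proof. by move=> ZO WO; rewrite {1}/rinner inner_kernel// Re_sum. Qed.

Lemma rinner_ev f n (Z : 'M[V]_n) u y : Omega Z ->
  rinner (ev f Z u) y = \sum_j rinner (sigma (u j) f) (kernel_elt Z j y).
Proof. by move=> ZO; rewrite {1}/rinner inner_ev// Re_sum. Qed.

(** [M] bounds the square of the norm of the map sending y to its kernel elements. *)
Definition kernel_elt_bound n (Z : 'M[V]_n) (M : R) :=
  forall y, sqsum (kernel_elt Z ^~ y) <= M * hnorm y ^+ 2.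

Lemma sqsum_kernel_elt n (Z : 'M[V]_n) x y : Omega Z ->
  \sum_i rinner (kernel_elt Z i x) (kernel_elt Z i y) = rinner (K Z Z 1%:M x) y.
Proof.
move=> ZO; rewrite rinner_kernel//; apply: eq_bigr => i _; congr rinner.
rewrite /rep_mx (bigD1 i)//= mxE eqxx (rep1 HK_rep) big1 ?addr0// => j ij.
by rewrite mxE eq_sym (negPf ij) (rep0l HK_rep).
Qed.

Lemma kernel_linear n m (Z : 'M[V]_n) (W : 'M[V]_m) P : Omega Z -> Omega W ->
  linear (K Z W P).
Proof. by move=> ZO WO; case: cpK => -[+ _ _] _ => /(_ _ _ Z W P ZO WO)[]. Qed.

Lemma opnorm_kernel_elt_bound n (Z : 'M[V]_n) (M : R) : Omega Z ->
  (opnorm (K Z Z 1%:M) <= M%:E)%E -> kernel_elt_bound Z M.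
Proof.
move=> ZO KM y; have -> : sqsum (kernel_elt Z ^~ y) = rinner (K Z Z 1%:M y) y.
  by rewrite -sqsum_kernel_elt//; apply: eq_bigr => i _; rewrite sqr_hnorm.
apply: le_trans (cauchy_schwarz _ _) _; rewrite expr2 mulrA ler_wpM2r ?hnorm_ge0//.
by apply: le_opnorm => //; exact: kernel_linear.
Qed.

(* From S^2 <= a (M S) to S <= a M for the sums of squares S below. *)
Let absorb (S a M : R) : 0 <= S -> 0 <= a -> 0 <= M ->
  S ^+ 2 <= a * (M * S) -> S <= M * a.
Proof.
move=> S0 a0 M0; have [->|Sn0] := eqVneq S 0; first by rewrite mulr_ge0.
by rewrite mulrA (mulrC a) expr2 ler_pM2r ?lt_def ?Sn0.
Qed.

Lemma sqsum_pair_kernel_elt (I : finType) n (Z : 'M[V]_n) (M : R) (y : I -> (Y ^ n)%type) :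
  kernel_elt_bound Z M ->
  sqsum (fun p : I * 'I_n => kernel_elt Z p.2 (y p.1)) <= M * sqsum y.
Proof.
move=> ZM; rewrite /sqsum -(pair_bigA _ (fun i j => hnorm (kernel_elt Z j (y i)) ^+ 2)) /=.
by rewrite mulr_sumr; apply: ler_sum => i _; exact: ZM.
Qed.

(** The values are paired with their own kernel elements, and [absorb] cancels. One-point [I] and
    [J] give the norm of f(Z), ['I_N] the level N of its cb-norm. *)
Lemma ev_bound (I J : finType) f n (Z : 'M[V]_n) (M : R) (s : I -> J -> (A ^ n)%type)
    (c : J -> R[i]) : Omega Z -> 0 <= M -> kernel_elt_bound Z M ->
  rep_mx_bound sigma (fun (p : I * 'I_n) j => s p.1 j p.2) 1 ->
  sqsum (fun i => \sum_j c j *: ev f Z (s i j)) <=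
    M * sqsum (fun j => c j *: f).
Proof.
move=> ZO M0 ZM sb; set y := fun i => \sum_j _.
apply: absorb; rewrite ?sqsum_ge0//.
pose P (p : I * 'I_n) j := s p.1 j p.2.
have E1 : sqsum y = \sum_p rinner (rep_mx sigma P (fun j => c j *: f) p)
                                 (kernel_elt Z p.2 (y p.1)).
  rewrite -(pair_bigA _ (fun i k => rinner (rep_mx sigma P (fun j => c j *: f) (i, k))
                                 (kernel_elt Z k (y i)))) /=.
  apply: eq_bigr => i _; rewrite sqr_hnorm {1}/y rinner_suml.
  under [RHS]eq_bigr do rewrite rinner_suml.
  rewrite exchange_big; apply: eq_bigr => j _ /=.
  by rewrite -evZ//; exact: rinner_ev.
rewrite {1}E1; apply: le_trans (cauchy_schwarz_sum _ _) _.
apply: ler_pM; rewrite ?sqsum_ge0//; first by rewrite -[leRHS]mul1r; exact: sb.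
exact: sqsum_pair_kernel_elt.
Qed.

(** The argument of [ev_bound] with kernel elements on both sides: those of [W] replace the
    multiples of f and contribute the factor N. *)
Lemma kernel_bound (I J : finType) n m (Z : 'M[V]_n) (W : 'M[V]_m) (M N c : R)
    (s : I -> J -> 'M[A]_(n, m)) (y : J -> (Y ^ m)%type) :
  Omega Z -> Omega W -> 0 <= M -> 0 <= N -> 0 <= c ->
  kernel_elt_bound Z M -> kernel_elt_bound W N ->
  rep_mx_bound sigma (fun (p : I * 'I_n) (q : J * 'I_m) => s p.1 q.1 p.2 q.2) c ->
  sqsum (fun i => \sum_j K Z W (s i j) (y j)) <= M * (c * (N * sqsum y)).
Proof.
move=> ZO WO M0 N0 c0 ZM WN sb; set x := fun i => \sum_j _.
apply: absorb; rewrite ?sqsum_ge0 ?mulr_ge0 ?sqsum_ge0//.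
pose P (p : I * 'I_n) (q : J * 'I_m) := s p.1 q.1 p.2 q.2.
pose X (q : J * 'I_m) := kernel_elt W q.2 (y q.1).
have E1 : sqsum x = \sum_p rinner (rep_mx sigma P X p) (kernel_elt Z p.2 (x p.1)).
  rewrite -(pair_bigA _ (fun i k => rinner (rep_mx sigma P X (i, k))
                                 (kernel_elt Z k (x i)))) /=.
  apply: eq_bigr => i _; rewrite sqr_hnorm {1}/x rinner_suml.
  rewrite (eq_bigr _ (fun j _ => rinner_kernel _ _ _ ZO WO)).
  rewrite exchange_big; apply: eq_bigr => k _ /=; rewrite -rinner_suml.
  by congr rinner; rewrite /rep_mx pair_bigA.
rewrite {1}E1; apply: le_trans (cauchy_schwarz_sum _ _) _.
apply: ler_pM; rewrite ?sqsum_ge0//; last exact: sqsum_pair_kernel_elt.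
apply: le_trans (sb X) _; rewrite ler_wpM2l//; exact: sqsum_pair_kernel_elt.
Qed.

End kernel_elements.

(** * Concrete operator space norms expressed by sums of squares *)

Section operator_spaces.
Context (R : realType).

Lemma linear_op_of_mx (X Y : preHilbertType R) p q (T : 'M[X -> Y]_(p, q)) :
  (forall i j, linear (T i j)) -> linear (op_of_mx T).
Proof.
move=> lT a x y; apply/ffunP => i; rewrite !ffunE scaler_sumr -big_split.
by apply: eq_bigr => j _; rewrite !ffunE lT.
Qed.

Lemma opnorm_le1 (X Y : preHilbertType R) (T : X -> Y) x : linear T ->
  (opnorm T <= 1)%E -> hnorm (T x) ^+ 2 <= hnorm x ^+ 2.
Proof.
move=> lT T1; rewrite ler_sqr ?nnegrE ?hnorm_ge0//.
by rewrite -[leRHS]mul1r; exact: le_opnorm.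
Qed.

Lemma hnorm_line (c : R[i]^o) : hnorm c = complex.Re `|c|.
Proof.
have -> : hnorm c = Num.sqrt (complex.Re (`|c : R[i]| ^+ 2)) by rewrite normCK.
by rewrite normc_def -rmorphXn /= sqrtr_sqr ger0_norm ?sqrtr_ge0.
Qed.

Lemma sqsum_scale (X : preHilbertType R) (x : X) n (c : (R[i]^o ^ n)%type) :
  sqsum (fun j => (c j : R[i]) *: x) = hnorm c ^+ 2 * hnorm x ^+ 2.
Proof.
rewrite sqr_hnorm_col /sqsum mulr_suml; apply: eq_bigr => j _.
by rewrite hnormZ exprMn hnorm_line.
Qed.

Lemma os_mx_column_hnorm (X : hilbertType R) n N (s : 'M[(X ^ n)%type]_N)
    (c : R) : 0 <= c ->
  (forall t : (R[i]^o ^ N)%type,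
    sqsum (fun i => \sum_j (t j : R[i]) *: s i j) <= c ^+ 2 * hnorm t ^+ 2) ->
  (os_norm (os_mx (os_column (X ^ n)%type) N) s <= c%:E)%E.
Proof.
move=> c0 sc; apply: opnorm_le => // t.
rewrite -ler_sqr ?nnegrE ?mulr_ge0 ?hnorm_ge0// exprMn sqr_hnorm_col.
apply: le_trans (sc t); rewrite le_eqVlt; apply/orP; left; apply/eqP.
apply: eq_bigr => i _; congr (hnorm _ ^+ 2); rewrite /= ffunE.
by apply: eq_bigr => j _; rewrite mxE.
Qed.

(** Column Hilbert spaces are homogeneous: applied to scalars t, a matrix s of columns yields the
    vectors sum_j t_j s_ij, and T acts on each of them separately, so no matrix level exceeds the
    norm of T. *)
Lemma hcbnorm_le (X Y : hilbertType R) n m (T : (X ^ n)%type -> (Y ^ m)%type) (c : R) :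
  linear T -> 0 <= c -> (forall x, hnorm (T x) <= c * hnorm x) ->
  (hcbnorm T <= c%:E)%E.
Proof.
move=> lT c0 Tc; apply: ge_ereal_sup => _ [N _ <-]; apply: map_norm_le => s s1.
apply: os_mx_column_hnorm => // t.
have lcol : linear (os_emb (os_mx (os_column (X ^ n)%type) N) s).
  apply: linear_op_of_mx => i j a u v; rewrite !mxE /=.
  by rewrite scalerDl scalerA.
apply: le_trans (ler_wpM2l (sqr_ge0 c) (opnorm_le1 t lcol s1)).
rewrite [X in _ <= _ * X](sqr_hnorm_col (X := (X ^ n)%type)).
rewrite mulr_sumr; apply: ler_sum => i _; rewrite -exprMn.
rewrite ler_sqr ?nnegrE ?mulr_ge0 ?hnorm_ge0//.
apply: le_trans (Tc _); rewrite ffunE le_eqVlt; apply/orP; left; apply/eqP; congr hnorm.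
rewrite (linear_big _ _ lT); apply: eq_bigr => j _; rewrite !mxE /=.
by rewrite (linear_scale _ _ lT).
Qed.

Context (A : cstarAlgType R) (E : hilbertType R) (pi : A -> E -> E).
Hypothesis piR : isometric_rep pi.

Let lin p q (P : 'M[A]_(p, q)) : linear (op_of_mx (map_mx pi P)).
Proof. by apply: linear_op_of_mx => i j; rewrite mxE; exact: rep_linear piR.1 _. Qed.

(** Rows are indexed by pairs (block, entry), with a single block here, the shape in which
    [ev_bound] takes its matrix. *)
Lemma enorm_alg_bound n (u : (A ^ n)%type) : (enorm_alg pi u <= 1)%E ->
  rep_mx_bound pi (fun (p : 'I_1 * 'I_n) (j : 'I_1) => u p.2) 1.
Proof.
move=> u1 x; pose X : (E ^ 1)%type := [ffun j => x j].
have := opnorm_le1 X (lin (mx_of_col u)) u1; rewrite !sqr_hnorm_col mul1r.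
congr (_ <= _); last by apply: eq_bigr => j _; rewrite ffunE.
rewrite /sqsum -(pair_bigA _ (fun i k => hnorm (rep_mx pi
  (fun (p : 'I_1 * 'I_n) (j : 'I_1) => u p.2) x (i, k)) ^+ 2)) big_ord1.
apply: eq_bigr => k _; congr (hnorm _ ^+ 2); rewrite ffunE.
by apply: eq_bigr => j _; rewrite !mxE ffunE.
Qed.

Lemma os_alg_col_bound n N (s : 'M[(A ^ n)%type]_N) :
  (os_norm (os_mx (os_alg_col pi n) N) s <= 1)%E ->
  rep_mx_bound pi (fun (p : 'I_N * 'I_n) (j : 'I_N) => s p.1 j p.2) 1.
Proof.
move=> s1 x; pose X : ((E ^ 1) ^ N)%type := [ffun j => [ffun _ => x j]].
have ls : linear (os_emb (os_mx (os_alg_col pi n) N) s).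
  by apply: linear_op_of_mx => i j; rewrite mxE; exact: lin.
have := opnorm_le1 X ls s1; rewrite !sqr_hnorm_col mul1r.
congr (_ <= _); last first.
  by apply: eq_bigr => j _; rewrite sqr_hnorm_col /sqsum big_ord1 !ffunE.
rewrite /sqsum -(pair_bigA _ (fun i k => hnorm (rep_mx pi
  (fun (p : 'I_N * 'I_n) (j : 'I_N) => s p.1 j p.2) x (i, k)) ^+ 2)).
apply: eq_bigr => i _; rewrite sqr_hnorm_col; apply: eq_bigr => k _.
congr (hnorm _ ^+ 2); rewrite /= ffunE sum_ffunE.
apply: eq_bigr => j _; rewrite mxE /= ffunE big_ord1 !mxE !ffunE.
by [].
Qed.

Lemma os_alg_mx_bound n m N (s : 'M['M[A]_(n, m)]_N) :
  (os_norm (os_mx (os_alg_mx pi n m) N) s <= 1)%E ->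
  rep_mx_bound pi (fun (p : 'I_N * 'I_n) (q : 'I_N * 'I_m) => s p.1 q.1 p.2 q.2) 1.
Proof.
move=> s1 x; pose X : ((E ^ m) ^ N)%type := [ffun j => [ffun l => x (j, l)]].
have ls : linear (os_emb (os_mx (os_alg_mx pi n m) N) s).
  by apply: linear_op_of_mx => i j; rewrite mxE; exact: lin.
have := opnorm_le1 X ls s1; rewrite !sqr_hnorm_col mul1r.
congr (_ <= _); last first.
  rewrite [RHS](_ : _ = \sum_j \sum_l hnorm (x (j, l)) ^+ 2); last first.
    by rewrite pair_bigA; apply: eq_bigr => -[].
  apply: eq_bigr => j _; rewrite sqr_hnorm_col; apply: eq_bigr => l _.
  by rewrite !ffunE.
rewrite /sqsum -(pair_bigA _ (fun i k => hnorm (rep_mx pi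
  (fun (p : 'I_N * 'I_n) (q : 'I_N * 'I_m) => s p.1 q.1 p.2 q.2) x (i, k)) ^+ 2)).
apply: eq_bigr => i _; rewrite sqr_hnorm_col; apply: eq_bigr => k _.
congr (hnorm _ ^+ 2); rewrite /= ffunE sum_ffunE /rep_mx.
rewrite [RHS](_ : _ = \sum_j \sum_l pi (s i j k l) (x (j, l))); last first.
  by rewrite pair_bigA; apply: eq_bigr => -[].
apply: eq_bigr => j _; rewrite mxE /= ffunE.
by apply: eq_bigr => l _; rewrite mxE !ffunE.
Qed.

Lemma enorm_alg_unit_col n (j : 'I_n) : (enorm_alg pi (unit_col j 1) <= 1)%E.
Proof.
apply: opnorm_le => // x; rewrite mul1r -ler_sqr ?nnegrE ?hnorm_ge0//.
rewrite !sqr_hnorm_col [leRHS]big_ord1 (_ : sqsum _ = hnorm (x 0) ^+ 2)//.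
rewrite /sqsum (bigD1 j)//= ffunE big_ord1 !mxE ffunE eqxx (rep1 piR.1).
rewrite big1 ?addr0// => k kj; rewrite ffunE big_ord1 !mxE ffunE (negPf kj).
by rewrite (rep0l piR.1) hnorm0 expr0n.
Qed.

Lemma os_alg_mx1 n :
  (os_norm (os_mx (os_alg_mx pi n n) 1) (const_mx 1%:M) <= 1)%E.
Proof.
apply: opnorm_le => // x; rewrite mul1r le_eqVlt; apply/orP; left; apply/eqP; congr hnorm.
apply/ffunP => i; rewrite ffunE big_ord1 !mxE (_ : i = ord0); last exact: ord1.
apply/ffunP => k; rewrite ffunE (bigD1 k)//= !mxE eqxx (rep1 piR.1).
rewrite big1 ?addr0// => l lk.
by rewrite !mxE eq_sym (negPf lk) (rep0l piR.1).
Qed.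

End operator_spaces.

(** * Norms and cb-norms of evaluations and of the kernel *)

Section norm_bounds.
Context (R : realType) (V : lmodType R[i]) (Omega : ncset V) (A : cstarAlgType R)
  (E : hilbertType R) (pi : A -> E -> E) (Y : hilbertType R)
  (K : nckernel V A Y) (H : hilbertType R) (ev : H -> ncmap V A Y)
  (sigma : A -> H -> H).
Hypotheses (piR : isometric_rep pi) (cpK : cp_nckernel Omega K)
  (HK : is_HK pi Omega ev sigma K).

Local Notation elt_bound := (kernel_elt_bound Omega K ev).

Lemma evnorm_le f n (Z : 'M[V]_n) (M : R) : Omega Z -> 0 <= M -> elt_bound Z M ->
  (evnorm pi (ev f Z) <= (Num.sqrt M * hnorm f)%:E)%E.
Proof.
move=> ZO M0 ZM; apply: map_norm_le => u /(enorm_alg_bound piR).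
move=> /(rep_mx_contractive piR (HK_rep HK) ler01) ub.
have := ev_bound (I := 'I_1) (J := 'I_1) HK f (s := fun _ _ => u) (fun _ => 1) ZO M0 ZM ub.
rewrite /sqsum !big_ord1 !scale1r => ub'.
rewrite lee_fin -ler_sqr ?nnegrE ?mulr_ge0 ?sqrtr_ge0 ?hnorm_ge0//.
by rewrite exprMn (sqr_sqrtr M0).
Qed.

Lemma evcbnorm_le f n (Z : 'M[V]_n) (M : R) : Omega Z -> 0 <= M -> elt_bound Z M ->
  (evcbnorm pi (ev f Z) <= (Num.sqrt M * hnorm f)%:E)%E.
Proof.
move=> ZO M0 ZM; apply: ge_ereal_sup => _ [N _ <-]; apply: map_norm_le => s.
move=> /(os_alg_col_bound piR) /(rep_mx_contractive piR (HK_rep HK) ler01) sb.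
apply: os_mx_column_hnorm => [|t]; first by rewrite mulr_ge0 ?sqrtr_ge0 ?hnorm_ge0.
have := ev_bound HK f (s := fun i j => s i j) t ZO M0 ZM sb.
have -> : (Num.sqrt M * hnorm f) ^+ 2 * hnorm t ^+ 2 =
    M * (hnorm t ^+ 2 * hnorm f ^+ 2) by rewrite exprMn (sqr_sqrtr M0); ring.
rewrite sqsum_scale.
congr (_ <= _); apply: eq_bigr => i _; congr (hnorm _ ^+ 2).
by apply: eq_bigr => j _; rewrite mxE.
Qed.

Lemma kercbnorm_le n m (Z : 'M[V]_n) (W : 'M[V]_m) (M N : R) :
  Omega Z -> Omega W -> 0 <= M -> 0 <= N -> elt_bound Z M -> elt_bound W N ->
  (kercbnorm pi (K Z W) <= (Num.sqrt (M * N))%:E)%E.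
Proof.
move=> ZO WO M0 N0 ZM WN; apply: ge_ereal_sup => _ [k _ <-].
apply: map_norm_le => s.
move=> /(os_alg_mx_bound piR) /(rep_mx_contractive piR (HK_rep HK) ler01) sb.
apply: opnorm_le => [|y]; first exact: sqrtr_ge0.
rewrite -ler_sqr ?nnegrE ?mulr_ge0 ?sqrtr_ge0 ?hnorm_ge0// exprMn.
rewrite (sqr_sqrtr (mulr_ge0 M0 N0)) !sqr_hnorm_col -mulrA.
have := kernel_bound cpK HK (s := fun i j => s i j) y ZO WO M0 N0 ler01 ZM WN sb.
rewrite mul1r; congr (_ <= _); apply: eq_bigr => i _; congr (hnorm _ ^+ 2).
by rewrite ffunE; apply: eq_bigr => j _; rewrite !mxE.
Qed.

(** [c] bounds the square of the norm of sigma(P); as P stays fixed along a slice, any value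
    supplied by [rep_mx_bounded] serves. *)
Lemma opnorm_kernel_le n m (Z : 'M[V]_n) (W : 'M[V]_m) (P : 'M[A]_(n, m)) (M N c : R) :
  Omega Z -> Omega W -> 0 <= M -> 0 <= N -> 0 <= c -> elt_bound Z M -> elt_bound W N ->
  rep_mx_bound sigma P c ->
  (opnorm (K Z W P) <= (Num.sqrt (M * (c * N)))%:E)%E.
Proof.
move=> ZO WO M0 N0 c0 ZM WN Pc; apply: opnorm_le => [|y]; first exact: sqrtr_ge0.
rewrite -ler_sqr ?nnegrE ?mulr_ge0 ?sqrtr_ge0 ?hnorm_ge0// exprMn.
rewrite (@sqr_sqrtr _ (M * (c * N))) ?mulr_ge0//.
have sb : rep_mx_bound sigma (fun (p : 'I_1 * 'I_n) (q : 'I_1 * 'I_m) => P p.2 q.2) c.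
  move=> x; have := Pc (fun l => x (0, l)).
  congr (_ <= c * _); last first.
    rewrite [RHS](_ : _ = \sum_(j : 'I_1) \sum_l hnorm (x (j, l)) ^+ 2).
      by rewrite big_ord1.
    by rewrite pair_bigA; apply: eq_bigr => -[].
  rewrite [RHS](_ : _ = \sum_(i : 'I_1) \sum_k
    hnorm (\sum_(j : 'I_1) \sum_l sigma (P k l) (x (j, l))) ^+ 2).
    by rewrite big_ord1; apply: eq_bigr => k _; rewrite big_ord1.
  rewrite pair_bigA; apply: eq_bigr => -[i k] _; congr (hnorm _ ^+ 2).
  by rewrite pair_bigA; apply: eq_bigr => -[].
have := kernel_bound (I := 'I_1) (J := 'I_1) cpK HK (s := fun _ _ => P) (fun _ => y)
  ZO WO M0 N0 c0 ZM WN sb.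
by rewrite /sqsum !big_ord1 !mulrA.
Qed.

(** Level N = 1 of the cb-norm, tested on the identity, already gives this; what remains is to
    identify 1 x 1 matrices of operators with operators. *)
Lemma opnorm_le_kercbnorm n (Z : 'M[V]_n) :
  (opnorm (K Z Z 1%:M) <= kercbnorm pi (K Z Z))%E.
Proof.
apply: (@le_trans _ _ (os_norm (os_mx (os_op (Y ^ n)%type (Y ^ n)%type) 1)
                        (map_mx (K Z Z) (const_mx 1%:M)))); last first.
  apply: (le_trans (le_map_norm _ _ (os_alg_mx1 piR n))).
  by apply: ereal_sup_ubound; exists 1%N.
apply: map_norm_le => y y1.
have col1 (X : preHilbertType R) (x : (X ^ 1)%type) : ehnorm x = ehnorm (x 0).
  by rewrite /ehnorm /hnorm /inner /= /col_inner big_ord1.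
have -> : ehnorm (K Z Z 1%:M y) = ehnorm (os_emb (os_mx (os_op (Y ^ n)%type (Y ^ n)%type) 1)
    (map_mx (K Z Z) (const_mx 1%:M)) [ffun _ => y]).
  by rewrite [RHS]col1 /= ffunE big_ord1 !mxE ffunE.
by apply: le_map_norm; rewrite [leLHS]col1 ffunE.
Qed.

Lemma kernel_elt_slice_bound n (Z D : 'M[V]_n) (e : R) : slice_in Omega Z D e ->
  (forall f, bounded_disc e (fun t => evnorm pi (ev f (slice Z D t)))) ->
  exists2 M : R, 0 <= M &
    forall t : R[i], `|t| < e%:C%C -> elt_bound (slice Z D t) M.
Proof.
move=> ZDe fb.
pose elts := [set g | exists t : R[i], `|t| < e%:C%C /\
  exists j (y : (Y ^ n)%type), hnorm y <= 1 /\ g = kernel_elt Omega K ev (slice Z D t) j y].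
have [f|B BP] := uniform_boundedness (S := elts).
  have [M MP] := fb f; exists M => _ [t [te [j [y [y1 ->]]]]].
  rewrite /rinner -(inner_kernel_elt HK)//; last exact: ZDe.
  apply: le_trans (cauchy_schwarz _ _) _.
  apply: le_trans (_ : hnorm (ev f (slice Z D t) (unit_col j 1)) <= M).
    by rewrite ler_piMr ?hnorm_ge0.
  rewrite -lee_fin; apply: le_trans (MP t te).
  exact: le_map_norm (enorm_alg_unit_col piR j).
(* The absolute value makes the constant nonnegative even when [elts] is empty. *)
have {}BP t j (y : (Y ^ n)%type) : `|t| < e%:C%C -> hnorm y <= 1 ->
    hnorm (kernel_elt Omega K ev (slice Z D t) j y) <= `|B|.
  move=> te y1; apply: (le_trans (BP _ _) (ler_norm B)).
  by exists t; split=> //; exists j, y.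
have M0 : 0 <= n%:R * (`|B| * `|B|) by rewrite !mulr_ge0.
exists (n%:R * (`|B| * `|B|)) => // t te; have ZO := ZDe t te.
apply: (opnorm_kernel_elt_bound cpK HK) => //.
(* The bound on unit vectors extends to all y through the operator norm of K(Z,Z)(1), whose pairings
   are sums of n inner products of kernel elements of norm at most |B|. *)
apply: map_norm_le => y; rewrite !lee_fin => y1.
apply: hnorm_le_rinner => x x1; rewrite -(sqsum_kernel_elt cpK HK)//.
rewrite mulr_natl -[n in leRHS]card_ord -sumr_const.
apply: ler_sum => i _; apply: le_trans (cauchy_schwarz _ _) _.
by rewrite ler_pM ?hnorm_ge0 ?BP.
Qed.

End norm_bounds.

(** * The factor of a Kolmogorov decomposition *)

Section kolmogorov_factor.
Context (R : realType) (V : lmodType R[i]) (Omega : ncset V) (A : cstarAlgType R)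
  (Y : hilbertType R) (K : nckernel V A Y) (X : hilbertType R)
  (sigmaX : A -> X -> X) (H : ncmap V X Y).
Hypotheses (cpK : cp_nckernel Omega K) (kH : kolmogorov Omega K sigmaX H).

Lemma kolmogorov_bounded n (Z : 'M[V]_n) : Omega Z -> bounded_op (H Z).
Proof. by move=> ZO; case: kH => _ [/(_ _ Z ZO)]. Qed.

(* ||H(Z)^* y||^2 = <K(Z,Z)(1) y, y> since K(Z,Z)(1) = H(Z) H(Z)^*. *)
Lemma kolmogorov_hnorm n (Z : 'M[V]_n) (M : R) x : Omega Z -> 0 <= M ->
  (opnorm (K Z Z 1%:M) <= M%:E)%E -> hnorm (H Z x) <= Num.sqrt M * hnorm x.
Proof.
move=> ZO M0 KM; have HZ := adjointP (kolmogorov_bounded ZO).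
have K1 y : K Z Z 1%:M y = H Z (adjoint (H Z) y).
  case: kH => sX _ ->//; congr (H Z _); apply/ffunP => i.
  rewrite ffunE (bigD1 i)//= !mxE eqxx (rep1 sX) big1 ?addr0// => j ij.
  by rewrite !mxE eq_sym (negPf ij) (rep0l sX).
have adj y : hnorm (adjoint (H Z) y) <= Num.sqrt M * hnorm y.
  rewrite -ler_sqr ?nnegrE ?mulr_ge0 ?sqrtr_ge0 ?hnorm_ge0// exprMn (sqr_sqrtr M0).
  rewrite sqr_hnorm {1}/rinner -HZ -K1.
  apply: le_trans (cauchy_schwarz _ _) _; rewrite expr2 mulrA ler_wpM2r ?hnorm_ge0//.
  by apply: le_opnorm => //; case: cpK => -[/(_ _ _ Z Z 1%:M ZO ZO)[]].
apply: hnorm_le_rinner => y y1; rewrite /rinner HZ.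
apply: le_trans (cauchy_schwarz _ _) _; rewrite mulrC ler_wpM2r ?hnorm_ge0//.
by apply: le_trans (adj y) _; rewrite ler_piMr ?sqrtr_ge0.
Qed.

End kolmogorov_factor.

Theorem theorem3p15 (R : realType) (V : lmodType R[i]) (Omega : ncset V)
    (A : cstarAlgType R) (E : hilbertType R) (pi : A -> E -> E)
    (Y : hilbertType R) :
  is_ncset Omega -> finitely_open Omega -> isometric_rep pi ->
  (forall K : nckernel V A Y,
     cp_nckernel Omega K -> I_locally_bounded_on_slices Omega K ->
     forall (HK : hilbertType R) (ev : HK -> ncmap V A Y)
       (sigma : A -> HK -> HK),
     is_HK pi Omega ev sigma K ->
     forall (X : hilbertType R) (sigmaX : A -> X -> X) (H : ncmap V X Y),
     minimal_kolmogorov Omega K sigmaX H ->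
     [/\ forall f,
           locally_bounded_on_slices (@evnorm R A Y E pi) Omega (ev f) /\
           locally_bounded_on_slices (@evcbnorm R A Y E pi) Omega (ev f),
         locally_bounded_on_slices
           (fun n => @opnorm R (X ^ n)%type (Y ^ n)%type) Omega H,
         locally_bounded_on_slices
           (fun n => @hcbnorm R (X ^ n)%type (Y ^ n)%type) Omega H &
         forall n (Z D : 'M[V]_n) (e : R),
           Omega n Z -> 0 < e -> slice_in Omega Z D e ->
           bounded_disc e
             (fun t => opnorm (K n n (slice Z D t) (slice Z D t) 1%:M)) ->
           [/\ forall f,
                 bounded_disc e (fun t => evnorm pi (ev f n (slice Z D t))) /\
                 bounded_disc e (fun t => evcbnorm pi (ev f n (slice Z D t))),
               bounded_disc e (fun t => opnorm (H n (slice Z D t))) &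
               bounded_disc e (fun t => hcbnorm (H n (slice Z D t)))]]) /\
  (forall (HH : hilbertType R) (ev : HH -> ncmap V A Y)
     (sigma : A -> HH -> HH),
     nc_functional_hilbert pi Omega ev sigma ->
     (forall n (Z D : 'M[V]_n), Omega n Z ->
        exists e : R, [/\ 0 < e, slice_in Omega Z D e &
          forall f, bounded_disc e (fun t => evnorm pi (ev f n (slice Z D t)))]) ->
     forall K : nckernel V A Y,
     cp_nckernel Omega K -> is_HK pi Omega ev sigma K ->
     [/\ P_locally_bounded_on_slices Omega K,
         cb_locally_bounded_on_slices pi Omega K &
         forall n (Z D : 'M[V]_n) (e : R),
           Omega n Z -> 0 < e -> slice_in Omega Z D e ->
           (forall f,
              bounded_disc e (fun t => evnorm pi (ev f n (slice Z D t)))) ->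
           (forall t : R[i], `|t| < e%:C%C ->
              opnorm (K n n (slice Z D t) (slice Z D t) 1%:M) =
              kercbnorm pi (K n n (slice Z D t) (slice Z D t))) /\
           bounded_disc e
             (fun t => kercbnorm pi (K n n (slice Z D t) (slice Z D t)))]).
Proof.
move=> _ _ piR; split.
  move=> K cpK KI HK ev sigma HKP X sigmaX H [kH _].
  (* The quantitative statement comes first; the local ones apply it with the radius that I-local
     boundedness provides. *)
  have bounds n (Z D : 'M[V]_n) (e : R) :
      Omega n Z -> 0 < e -> slice_in Omega Z D e ->
      bounded_disc e (fun t => opnorm (K n n (slice Z D t) (slice Z D t) 1%:M)) ->
      [/\ forall f,
            bounded_disc e (fun t => evnorm pi (ev f n (slice Z D t))) /\
            bounded_disc e (fun t => evcbnorm pi (ev f n (slice Z D t))),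
          bounded_disc e (fun t => opnorm (H n (slice Z D t))) &
          bounded_disc e (fun t => hcbnorm (H n (slice Z D t)))].
    move=> ZO e0 ZDe [M0 KM0]; pose M := `|M0|; have Mge0 : 0 <= M by exact: normr_ge0.
    have {KM0} KM t : `|t| < e%:C%C ->
        (opnorm (K n n (slice Z D t) (slice Z D t) 1%:M) <= M%:E)%E.
      by move=> te; apply: le_trans (KM0 t te) _; rewrite lee_fin ler_norm.
    have ZM t : `|t| < e%:C%C -> kernel_elt_bound Omega K ev (slice Z D t) M.
      by move=> te; apply: (opnorm_kernel_elt_bound cpK HKP); [exact: ZDe | exact: KM].
    have HM t x : `|t| < e%:C%C ->
        hnorm (H n (slice Z D t) x) <= Num.sqrt M * hnorm x.
      by move=> te; apply: (kolmogorov_hnorm cpK kH) (KM t te); first exact: ZDe.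
    split=> [f||].
    - split; exists (Num.sqrt M * hnorm f) => t te.
        by apply: (evnorm_le piR HKP) (ZM t te); first exact: ZDe.
      by apply: (evcbnorm_le piR HKP) (ZM t te); first exact: ZDe.
    - exists (Num.sqrt M) => t te; apply: opnorm_le; first exact: sqrtr_ge0.
      by move=> x; exact: HM.
    - exists (Num.sqrt M) => t te; apply: hcbnorm_le; rewrite ?sqrtr_ge0//.
        by case: (kolmogorov_bounded kH (ZDe t te)).
      by move=> x; exact: HM.
  have slices n (Z D : 'M[V]_n) : Omega n Z -> exists e : R,
      [/\ 0 < e, slice_in Omega Z D e & bounded_disc e
        (fun t => opnorm (K n n (slice Z D t) (slice Z D t) 1%:M))] by exact: KI.
  split=> //.
  - move=> f; split=> n Z D ZO; have [e [e0 ZDe Ke]] := slices n Z D ZO;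
      exists e; split=> //; have [fb _ _] := bounds n Z D e ZO e0 ZDe Ke;
      by have [] := fb f.
  - move=> n Z D ZO; have [e [e0 ZDe Ke]] := slices n Z D ZO.
    by exists e; split=> //; have [] := bounds n Z D e ZO e0 ZDe Ke.
  - move=> n Z D ZO; have [e [e0 ZDe Ke]] := slices n Z D ZO.
    by exists e; split=> //; have [] := bounds n Z D e ZO e0 ZDe Ke.
move=> HH ev sigma _ evb K cpK HKP.
(* Each of the two slices comes with its own radius; their minimum serves both. *)
have pair n m (Z DZ : 'M[V]_n) (W DW : 'M[V]_m) : Omega n Z -> Omega m W ->
    exists e M N : R, [/\ 0 < e, slice_in Omega Z DZ e, slice_in Omega W DW e,
      0 <= M /\ 0 <= N & forall t : R[i], `|t| < e%:C%C ->
        kernel_elt_bound Omega K ev (slice Z DZ t) M /\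
        kernel_elt_bound Omega K ev (slice W DW t) N].
  move=> ZO WO; have [e [e0 Ze fZ]] := evb _ Z DZ ZO.
  have [d [d0 Wd fW]] := evb _ W DW WO.
  have [M M0 ZM] := kernel_elt_slice_bound piR cpK HKP Ze fZ.
  have [N N0 WN] := kernel_elt_slice_bound piR cpK HKP Wd fW.
  have le_e (t : R[i]) : `|t| < (Num.min e d)%:C%C -> `|t| < e%:C%C.
    by move/lt_le_trans; apply; rewrite lecR ge_min lexx.
  have le_d (t : R[i]) : `|t| < (Num.min e d)%:C%C -> `|t| < d%:C%C.
    by move/lt_le_trans; apply; rewrite lecR ge_min lexx orbT.
  exists (Num.min e d), M, N; split=> //; first by rewrite lt_min e0.
  - by move=> t /le_e; exact: Ze.
  - by move=> t /le_d; exact: Wd.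
  - by move=> t te; split; [exact/ZM/le_e | exact/WN/le_d].
split.
- move=> n m Z DZ W DW P ZO WO.
  have [e [M [N [e0 Ze We [M0 N0] MN]]]] := pair _ _ Z DZ W DW ZO WO.
  exists e; split=> //; have [c c0 Pc] := rep_mx_bounded (HK_rep HKP) P.
  exists (Num.sqrt (M * (c * N))) => t te; have [ZM WN] := MN t te.
  by apply: (opnorm_kernel_le cpK HKP) M0 N0 c0 ZM WN Pc; [exact: Ze | exact: We].
- move=> n m Z DZ W DW ZO WO.
  have [e [M [N [e0 Ze We [M0 N0] MN]]]] := pair _ _ Z DZ W DW ZO WO.
  exists e; split=> //; exists (Num.sqrt (M * N)) => t te; have [ZM WN] := MN t te.
  by apply: (kercbnorm_le piR cpK HKP) ZM WN => //; [exact: Ze | exact: We].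
- move=> n Z D e ZO e0 ZDe fb.
  have [M M0 ZM] := kernel_elt_slice_bound piR cpK HKP ZDe fb; split.
    move=> t te; have ZtO := ZDe t te.
    apply/eqP; rewrite eq_le opnorm_le_kercbnorm//=.
    have bK : bounded_op (K n n (slice Z D t) (slice Z D t) 1%:M).
      by case: cpK => -[/(_ _ _ _ _ 1%:M ZtO ZtO)].
    (* Unlike the uniform [M], the exact norm [c] of K(Z,Z)(1) at this t is a sharp constant: the
       bound sqrt(c c) on the cb-norm is that norm itself. *)
    have [c Kc c0] := bounded_op_opnorm bK.
    have Zc : kernel_elt_bound Omega K ev (slice Z D t) c.
      by apply: (opnorm_kernel_elt_bound cpK HKP) => //; rewrite Kc.
    rewrite Kc -[c in leRHS]ger0_norm// -sqrtr_sqr expr2.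
    exact: (kercbnorm_le piR cpK HKP).
  exists (Num.sqrt (M * M)) => t te; have ZtO := ZDe t te.
  by apply: (kercbnorm_le piR cpK HKP) => //; exact: ZM.
Qed.
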